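(* Let $\mathcal{B}$ be a $C^*$-algebra, let $D,E,F$ be Hilbert $\mathcal{B}$-modules, and let $v\colon E\to F$ and $w\colon D\to E$ be partial isometries (not assumed adjointable). Then $vw$ is a partial isometry if and only if $\pi_v$ leaves $wD$ invariant, that is, if and only if for every $x\in D$ there is $y\in D$ such that $\pi_vwx=wy$.
   Context: Hilbert $\mathcal{B}$-modules are right modules, with inner product $\langle\cdot,\cdot\rangle$ conjugate-linear in the first and right $\mathcal{B}$-linear in the second argument. A unitary between Hilbert modules is a surjective inner product preserving map. A coisometry is a contractive right linear map $E\to F$ between Hilbert $\mathcal{B}$-modules for which there exists a submodule $E'$ of $E$ such that the map restricts to a unitary $E'\to F$. (Coisometries are known to be automatically adjointable, with isometric adjoint.) A map $v\colon E\to F$ between Hilbert $\mathcal{B}$-modules is a partial isometry if it corestricts to a coisometry $v_s\colon E\to vE$ (in particular, $v$ is right linear and contractive and $vE$ is itself a Hilbert $\mathcal{B}$-module, i.e. a closed submodule of $F$). A partial isometry need not be adjointable, but $v_s$ is, with adjoint $v_s^*\colon vE\to E$. The initial projection of $v$ is $\pi_v:=v_s^*v_s$; it is the unique projection on $E$ satisfying $v\pi_v=v$ and $(\mathbf{1}-\pi_v)E=\ker v$. A projection on $E$ is an adjointable map $p\colon E\to E$ with $p^*p=p$. *)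

(* Defs.v *)
From HB Require Import structures.
From mathcomp Require Import all_boot all_order all_algebra.
From mathcomp Require Import all_classical all_reals all_analysis.
From mathcomp Require Import complex.

Set Implicit Arguments.
Unset Strict Implicit.
Unset Printing Implicit Defensive.

Import Order.TTheory GRing.Theory Num.Theory.
Import numFieldNormedType.Exports.

Local Open Scope classical_set_scope.
Local Open Scope ring_scope.

(* Complex C*-algebras, not assumed unital (hence not built on MathComp rings,
   which have a unit). The norm takes its (real, nonnegative) values in R[i]. *)
HB.mixin Record isCStarAlgebra (R : realType) B
    of CompleteNormedModule R[i] B := {
  cmul : B -> B -> B;
  cstar : B -> B;
  cmulA : associative cmul;
  cmulDl : left_distributive cmul +%R;
  cmulDr : right_distributive cmul +%R;
  cmulZl : forall (k : R[i]) (a b : B), cmul (k *: a) b = k *: cmul a b;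
  cmulZr : forall (k : R[i]) (a b : B), cmul a (k *: b) = k *: cmul a b;
  cstarK : involutive cstar;
  cstarD : {morph cstar : a b / a + b};
  cstarZ : forall (k : R[i]) (a : B), cstar (k *: a) = k^* *: cstar a;
  cstarM : forall a b : B, cstar (cmul a b) = cmul (cstar b) (cstar a);
  cnormM : forall a b : B, `|cmul a b| <= `|a| * `|b|;
  cnorm_star_mul : forall a : B, `|cmul (cstar a) a| = `|a| ^+ 2
}.

#[short(type="cstarAlgType")]
HB.structure Definition CStarAlgebra (R : realType) :=
  {B of CompleteNormedModule R[i] B & isCStarAlgebra R B}.

Definition cpositive (R : realType) (B : cstarAlgType R) (a : B) : Prop :=
  exists b : B, a = cmul (cstar b) b.

(* Right Hilbert B-modules. Completeness for the norm ||<x, x>||^(1/2) is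
   completeness of the underlying normed space, by [inner_norm]; this axiom
   also gives definiteness of the inner product. *)
HB.mixin Record isHilbertModule (R : realType) (B : cstarAlgType R) E
    of CompleteNormedModule R[i] E := {
  act : E -> B -> E;
  inner : E -> E -> B;
  actDl : forall (x y : E) (b : B), act (x + y) b = act x b + act y b;
  actDr : forall (x : E) (a b : B), act x (a + b) = act x a + act x b;
  actZl : forall (k : R[i]) (x : E) (b : B), act (k *: x) b = k *: act x b;
  actZr : forall (k : R[i]) (x : E) (b : B), act x (k *: b) = k *: act x b;
  actM : forall (x : E) (a b : B), act x (cmul a b) = act (act x a) b;
  innerDr : forall x y z : E, inner x (y + z) = inner x y + inner x z;
  innerZr : forall (k : R[i]) (x y : E), inner x (k *: y) = k *: inner x y;
  inner_act : forall (x y : E) (b : B), inner x (act y b) = cmul (inner x y) b;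
  inner_star : forall x y : E, cstar (inner x y) = inner y x;
  inner_positive : forall x : E, cpositive (inner x x);
  inner_norm : forall x : E, `|x| ^+ 2 = `|inner x x|
}.

#[short(type="hilbertModType")]
HB.structure Definition HilbertModule (R : realType) (B : cstarAlgType R) :=
  {E of CompleteNormedModule R[i] E & isHilbertModule R B E}.

Section Maps.
Context {R : realType} {B : cstarAlgType R}.

Definition submodule (E : hilbertModType B) (S : set E) : Prop :=
  [/\ S 0,
      forall x y, S x -> S y -> S (x + y),
      forall (k : R[i]) x, S x -> S (k *: x)
    & forall x (b : B), S x -> S (act x b)].

(* The submodules that are Hilbert modules for the inherited structure. *)
Definition hilbert_submodule (E : hilbertModType B) (S : set E) : Prop :=
  submodule S /\ closed S.

Definition right_linear (E F : hilbertModType B) (v : E -> F) : Prop :=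
  [/\ forall x y, v (x + y) = v x + v y,
      forall (k : R[i]) x, v (k *: x) = k *: v x
    & forall x (b : B), v (act x b) = act (v x) b].

Definition contractive (E F : hilbertModType B) (v : E -> F) : Prop :=
  forall x, `|v x| <= `|x|.

(* [v] restricts to a unitary from [S] onto [G]. *)
Definition unitary_between (E F : hilbertModType B) (v : E -> F)
    (S : set E) (G : set F) : Prop :=
  (forall x y, S x -> S y -> inner (v x) (v y) = inner x y) /\ v @` S = G.

(* [v], corestricted to the Hilbert submodule [G] of [F], is a coisometry
   [E -> G]; coisometries [E -> F] are the case [G = setT]. *)
Definition coisometry_onto (E F : hilbertModType B) (v : E -> F) (G : set F) :
    Prop :=
  [/\ hilbert_submodule G,
      range v `<=` G,
      right_linear v,
      contractive v
    & exists E' : set E, submodule E' /\ unitary_between v E' G].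

Definition partial_isometry (E F : hilbertModType B) (v : E -> F) : Prop :=
  coisometry_onto v (range v).

(* The adjoint [v_s^* : vE -> E] of the corestriction [v_s : E -> vE] of [v]:
   for [z] in [range v] on which the adjoint is defined, [corestr_adj v z] is
   the unique [y] with [<x, y> = <v x, z>] for all [x]; it is 0 where no
   adjoint exists or off the range of [v]. *)
Definition corestr_adj (E F : hilbertModType B) (v : E -> F) (z : F) : E :=
  xget 0 [set y : E | range v z /\ forall x, inner x y = inner (v x) z].

Definition initial_projection (E F : hilbertModType B) (v : E -> F) : E -> E :=
  fun x => corestr_adj v (v x).

Definition leaves_invariant (E : hilbertModType B) (p : E -> E) (S : set E) :
    Prop := p @` S `<=` S.

End Maps.

(* Main.v *)
Require Import Defs.
From HB Require Import structures.
From mathcomp Require Import all_boot all_order all_algebra.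
From mathcomp Require Import all_classical all_reals all_analysis.
From mathcomp Require Import complex lra ring.
From Stdlib Require Ncring Ncring_tac.

(* A right linear contraction v satisfies <v x, v x> <= <x, x>. If v preserves
   <e, e>, comparing <e, e> with <e - k b, e - k b> for k in ker v and small b
   shows that e is orthogonal to ker v. Hence the initial projection p of v is
   characterized by <x, p y> = <v x, v y>, and v p = v.
   If p w D is contained in w D, then v w is isometric on the common fixed
   points of q (the initial projection of w) and of p w (relative to w), and its
   range is the isometric image under v of p w D, whose Cauchy sequences
   converge in w D. Conversely, if y is in the initial space of v w, then
   <w y - p w y, w y - p w y> = - <y - q y, y - q y>, and both sides vanish
   because the positive cone of B is salient.
   The order theory of B rests on the positivity of c^* c (Kelley-Vaught). It is
   proved in the algebra of multipliers of B, where a unit is available, from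
   square roots of 1 - h, |h| < 1, obtained by Banach's fixed point theorem. *)

Set Implicit Arguments.
Unset Strict Implicit.
Unset Printing Implicit Defensive.

Import Order.TTheory GRing.Theory Num.Theory.
Import numFieldNormedType.Exports.

Local Open Scope classical_set_scope.
Local Open Scope ring_scope.

(** * Positivity in unital C*-algebras *)

#[local] Instance ncring_ops (A : pzRingType) :
  @Ncring.Ring_ops A 0 1 +%R *%R (fun x y => x - y) -%R eq := {}.

#[local] Instance ncring_ring (A : pzRingType) : Ncring.Ring (Ro := ncring_ops A).
Proof.
split; rewrite /Ncring.eq_notation /Algebra_syntax.equality.
- exact: RelationClasses.eq_equivalence.
- by move=> ? ? -> ? ? ->.
- by move=> ? ? -> ? ? ->.
- by move=> ? ? -> ? ? ->.
- by move=> ? ? ->.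
- exact: add0r.
- exact: addrC.
- exact: addrA.
- exact: mul1r.
- exact: mulr1.
- exact: mulrA.
- by move=> *; exact: mulrDl.
- by move=> *; exact: mulrDr.
- by [].
- exact: subrr.
Qed.

Ltac ncring := Ncring_tac.non_commutative_ring.

HB.mixin Record isUnitalCStar (R : realType) A of GRing.PzRing A := {
  emb : R -> A;
  ustar : A -> A;
  imag : A;
  nrm : A -> R;
  embB : {morph emb : s t / s - t};
  embM : {morph emb : s t / s * t};
  emb1 : emb 1 = 1;
  embC : forall t a, emb t * a = a * emb t;
  ustarK : involutive ustar;
  ustarB : {morph ustar : a b / a - b};
  ustarM : forall a b : A, ustar (a * b) = ustar b * ustar a;
  ustar_emb : forall t, ustar (emb t) = emb t;
  imagC : forall a : A, imag * a = a * imag;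
  imag2 : imag * imag = -1;
  ustar_imag : ustar imag = - imag;
  nrm_ge0 : forall a, 0 <= nrm a;
  nrm_eq0 : forall a, nrm a = 0 -> a = 0;
  nrmD : forall a b, nrm (a + b) <= nrm a + nrm b;
  nrmM : forall a b, nrm (a * b) <= nrm a * nrm b;
  nrm_emb : forall t a, nrm (emb t * a) = `|t| * nrm a;
  nrm1 : nrm 1 <= 1;
  nrm_star_mul : forall a, nrm (ustar a * a) = nrm a ^+ 2;
  nrm_complete : forall (u : nat -> A) (C r : R), 0 <= r < 1 ->
    (forall n, nrm (u n.+1 - u n) <= C * r ^+ n) ->
    exists l, forall e, 0 < e -> exists N, forall n, (N <= n)%N ->
      nrm (u n - l) <= e
}.

#[short(type="unitalCStarType")]
HB.structure Definition UnitalCStar (R : realType) :=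
  {A of GRing.PzRing A & isUnitalCStar R A}.

(** * Scalars, adjoints and the norm *)

Section Unital.
Context {R : realType} {A : unitalCStarType R}.
Implicit Types (a b c h q x y : A) (s t r e m : R).
Local Notation "t %:U" := (emb t : A) (at level 2, format "t %:U").

Lemma emb0 : 0%:U = 0. Proof. by rewrite -[X in emb X](subrr (0 : R)) embB subrr. Qed.
Lemma embN t : (- t)%:U = - t%:U. Proof. by rewrite -sub0r embB emb0 sub0r. Qed.
Lemma embD s t : (s + t)%:U = s%:U + t%:U.
Proof. by rewrite -{1}[t]opprK embB embN opprK. Qed.
Lemma ustar0 : ustar (0 : A) = 0.
Proof. by rewrite -[X in ustar X](subrr (0 : A)) ustarB subrr. Qed.
Lemma ustarN a : ustar (- a) = - ustar a.
Proof. by rewrite -sub0r ustarB ustar0 sub0r. Qed.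
Lemma ustarD : {morph (@ustar R A) : a b / a + b}.
Proof. by move=> a b; rewrite -{1}[b]opprK ustarB ustarN opprK. Qed.
Lemma ustar1 : ustar (1 : A) = 1.
Proof. by rewrite -emb1 ustar_emb. Qed.

Lemma nrm0 : nrm (0 : A) = 0.
Proof. by rewrite -(mul0r (0 : A)) -emb0 nrm_emb normr0 mul0r. Qed.
Lemma nrmN a : nrm (- a) = nrm a.
Proof. by rewrite -mulN1r -emb1 -embN nrm_emb normrN1 mul1r. Qed.
Lemma nrm_distC a b : nrm (a - b) = nrm (b - a).
Proof. by rewrite -opprB nrmN. Qed.
Lemma nrmB a b : nrm (a - b) <= nrm a + nrm b.
Proof. by rewrite -[nrm b]nrmN nrmD. Qed.
Lemma nrm_embl t : nrm (t%:U) <= `|t|.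
Proof. by rewrite -[t%:U]mulr1 nrm_emb ler_piMr// nrm1. Qed.

Lemma nrm_star a : nrm (ustar a) = nrm a.
Proof.
suff le b : nrm b <= nrm (ustar b) by apply/eqP; rewrite eq_le -{2}[a]ustarK !le.
have [b0|b0] := eqVneq (nrm b) 0; first by rewrite b0 nrm_ge0.
rewrite -(@ler_pM2r _ (nrm b)) ?lt_def ?b0 ?nrm_ge0// -expr2 -nrm_star_mul.
exact: nrmM.
Qed.

Lemma nrm_mul_star a : nrm (a * ustar a) = nrm a ^+ 2.
Proof. by rewrite -{1}[a]ustarK nrm_star_mul nrm_star. Qed.

Definition sa a := ustar a = a.

Lemma sa_emb t : sa t%:U. Proof. exact: ustar_emb. Qed.
Lemma sa1 : sa 1. Proof. exact: ustar1. Qed.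
Lemma saD a b : sa a -> sa b -> sa (a + b).
Proof. by rewrite /sa ustarD => -> ->. Qed.
Lemma saB a b : sa a -> sa b -> sa (a - b).
Proof. by rewrite /sa ustarB => -> ->. Qed.
Lemma saM a b : sa a -> sa b -> a * b = b * a -> sa (a * b).
Proof. by rewrite /sa ustarM => -> ->. Qed.
Lemma saZ t a : sa a -> sa (t%:U * a).
Proof. by move=> h; rewrite /sa ustarM h ustar_emb embC. Qed.
Lemma sa_sq a : sa a -> sa (a * a). Proof. by move=> h; exact: saM. Qed.
Lemma sa_star_mul a : sa (ustar a * a).
Proof. by rewrite /sa ustarM ustarK. Qed.

Lemma nrm_sa2 a : sa a -> nrm (a * a) = nrm a ^+ 2.
Proof. by rewrite -nrm_star_mul => ->. Qed.

Lemma comm_emb t a : GRing.comm a t%:U.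
Proof. exact/esym/embC. Qed.

(** * Fixed points of contractions, with roots and inverses near 1 *)

Lemma le_add_eps s t : (forall e, 0 < e -> s <= t + e) -> s <= t.
Proof. by move=> H; apply/ler_addgt0Pr. Qed.

Lemma nrm_approx0 a : (forall e, 0 < e -> nrm a <= e) -> a = 0.
Proof.
move=> H; apply: nrm_eq0; apply/eqP; rewrite eq_le nrm_ge0 andbT.
by apply: le_add_eps => e e0; rewrite add0r H.
Qed.

(** Closedness for the metric of [nrm], phrased by approximation since no topology is attached to
    [A]. *)
Definition approx_closed (S : set A) :=
  forall u, (forall e, 0 < e -> exists2 v, S v & nrm (u - v) <= e) -> S u.

(** Banach's iteration from 0. The set [S] carries self-adjointness, norm bounds and commutation
    relations over to the fixed point. *)
Lemma fixed_point (S : set A) (f : A -> A) r : 0 <= r < 1 -> S 0 ->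
  approx_closed S -> (forall u, S u -> S (f u)) ->
  (forall u v, S u -> S v -> nrm (f u - f v) <= r * nrm (u - v)) ->
  exists2 p, S p & p = f p.
Proof.
move=> r01 S0 clS Sf fr; have /andP[r0 r1] := r01.
pose u n := iter n f 0.
have Su n : S (u n) by elim: n => [//|n IH]; exact: Sf.
have ur n : nrm (u n.+1 - u n) <= nrm (f 0) * r ^+ n.
  elim: n => [|n IH]; first by rewrite expr0 mulr1 subr0.
  apply: (le_trans (fr _ _ (Su n.+1) (Su n))).
  by rewrite exprS mulrCA ler_wpM2l.
have [l Hl] := nrm_complete u _ _ r01 ur.
have Sl : S l.
  apply: clS => e e0; have [N HN] := Hl e e0; exists (u N) => //.
  by rewrite nrm_distC HN.
exists l => //; apply/eqP; rewrite -subr_eq0; apply/eqP/nrm_approx0 => e e0.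
have [N HN] := Hl (e / 2) ltac:(lra).
have -> : l - f l = (l - u N.+1) + (u N.+1 - f l) by rewrite addrA subrK.
apply: le_trans (nrmD _ _) _.
have h1 := HN _ (leqnSn N); have h2 := HN _ (leqnn N).
have h3 : nrm (u N.+1 - f l) <= r * nrm (u N - l) by exact: fr.
have : r * nrm (u N - l) <= 1 * nrm (u N - l).
  by rewrite ler_wpM2r ?nrm_ge0// ltW.
rewrite (nrm_distC l); lra.
Qed.

Lemma comm_closed b : approx_closed [set u | GRing.comm b u].
Proof.
move=> u H; apply/eqP; rewrite -subr_eq0; apply/eqP/nrm_approx0 => e e0.
(* The added 1 keeps the denominator positive when [b] is 0. *)
have b1 : 0 < 2 * nrm b + 1 by have := nrm_ge0 b; lra.
have [v /= bv uv] := H (e / (2 * nrm b + 1)) (divr_gt0 e0 b1).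
have -> : b * u - u * b = b * (u - v) - (u - v) * b.
  have -> : b * u - u * b = b * (u - v) - (u - v) * b + (b * v - v * b) by ncring.
  by rewrite bv subrr addr0.
apply: le_trans (nrmB _ _) _.
apply: le_trans (lerD (nrmM _ _) (nrmM _ _)) _.
rewrite mulrC -mulrDr.
apply: (@le_trans _ _ (e / (2 * nrm b + 1) * (nrm b + nrm b))).
  by rewrite ler_wpM2r// addr_ge0 ?nrm_ge0.
by rewrite mulrAC ler_pdivrMr// ler_wpM2l ?(ltW e0)//; lra.
Qed.

Lemma sa_closed : approx_closed [set u | sa u].
Proof.
move=> u H; apply/eqP; rewrite -subr_eq0; apply/eqP/nrm_approx0 => e e0.
have [v /= sv uv] := H (e / 2) ltac:(lra).
have -> : ustar u - u = ustar (u - v) - (u - v) by rewrite ustarB sv opprB addrA subrK.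
apply: le_trans (nrmB _ _) _; rewrite nrm_star; lra.
Qed.

Lemma ball_closed r : approx_closed [set u | nrm u <= r].
Proof.
move=> u H; apply: le_add_eps => e e0; have [v /= vr uv] := H e e0.
rewrite -(subrK v u); apply: le_trans (nrmD _ _) _; lra.
Qed.

Lemma approx_closedI S T : approx_closed S -> approx_closed T ->
  approx_closed (S `&` T).
Proof.
move=> hS hT u H; split; [apply: hS|apply: hT] => e /H[v [Sv Tv] uv];
  by exists v.
Qed.

Lemma approx_closed_bigcap (I : Type) (P : set I) (S : I -> set A) :
  (forall i, P i -> approx_closed (S i)) -> approx_closed (\bigcap_(i in P) S i).
Proof.
by move=> hS u H i Pi; apply: (hS i Pi) => e /H[v Sv uv]; exists v => //; exact: Sv.
Qed.

(** Membership of [q] in the bicommutant of [h]; it replaces functional calculus as the source of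
    commutation between roots and inverses. *)
Definition bicommutes h q := forall y, GRing.comm y h -> GRing.comm y q.

(* The root is [1 - q], with [q] the fixed point of [q |-> (h + q^2)/2]. *)
Lemma sqrt_sub1 h r : 0 <= r < 1 -> sa h -> nrm h <= r ->
  exists q, [/\ sa q, nrm q <= r, bicommutes h q & (1 - q) * (1 - q) = 1 - h].
Proof.
move=> r01 hs hr; have /andP[r0 r1] := r01.
pose S := [set u | sa u] `&` [set u | nrm u <= r] `&`
   \bigcap_(y in [set y | GRing.comm y h]) [set u | GRing.comm y u].
have [] := @fixed_point S (fun q => 2^-1%:U * (h + q * q)) r r01.
- split; first by split; rewrite /= /sa ?ustar0 ?nrm0.
  by move=> y _ /=; rewrite /GRing.comm mulr0 mul0r.
- apply: approx_closedI; last by apply: approx_closed_bigcap => i _; exact: comm_closed.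
  by apply: approx_closedI; [exact: sa_closed|exact: ball_closed].
- move=> u [[su ur] cu]; split; first split.
  + exact/saZ/saD/sa_sq.
  + rewrite /= nrm_emb ger0_norm ?invr_ge0//.
    have h1 := nrmD h (u * u); have h2 := nrmM u u.
    have : nrm u * nrm u <= r * r by rewrite ler_pM ?nrm_ge0.
    have : r * r <= r by rewrite ler_piMr// ltW.
    lra.
  + move=> y /= yh; have yu := cu _ yh.
    apply: commrM; first exact: comm_emb.
    by apply: commrD => //; apply: commrM.
- move=> u v [[su ur] _] [[sv vr] _].
  (* The difference [u^2 - v^2] splits without commutativity, and half of [|u| + |v|] is at most the
     contraction constant [r]. *)
  have -> : 2^-1%:U * (h + u * u) - 2^-1%:U * (h + v * v)
     = 2^-1%:U * (u * (u - v) + (u - v) * v).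
    rewrite -mulrBr; congr (_ * _).
    ncring.
  rewrite nrm_emb ger0_norm ?invr_ge0//.
  have h1 := nrmD (u * (u - v)) ((u - v) * v).
  have h2 := nrmM u (u - v); have h3 := nrmM (u - v) v.
  have h4 : nrm u * nrm (u - v) <= r * nrm (u - v) by rewrite ler_wpM2r ?nrm_ge0.
  have h5 : nrm (u - v) * nrm v <= r * nrm (u - v) by rewrite mulrC ler_wpM2r ?nrm_ge0.
  lra.
move=> q [[/= qs qr] qc] qE; exists q; split => //.
have q2 : q + q = h + q * q.
  rewrite {1 2}qE -mulrDl -embD.
  have -> : 2^-1 + 2^-1 = 1 :> R by lra.
  by rewrite emb1 mul1r.
have -> : (1 - q) * (1 - q) = 1 - h + ((h + q * q) - (q + q)) by ncring.
by rewrite q2 subrr addr0.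
Qed.

(** Fixed points of [k |-> 1 + q k] and [k |-> 1 + k q] are a right and a left inverse, hence
    equal. *)
Lemma inv_sub1 q r : 0 <= r < 1 -> nrm q <= r ->
  exists2 k, k * (1 - q) = 1 & (1 - q) * k = 1.
Proof.
move=> r01 qr.
have fc (u v : A) : 1 + q * u - (1 + q * v) = q * (u - v) by ncring.
have fc' (u v : A) : 1 + u * q - (1 + v * q) = (u - v) * q by ncring.
have clT : approx_closed setT by [].
have [//|//|//|u v _ _|k _ kE] := @fixed_point setT (fun k => 1 + q * k) r r01.
  rewrite fc; apply: le_trans (nrmM _ _) _; by rewrite ler_wpM2r ?nrm_ge0.
have [//|//|//|u v _ _|k' _ kE'] := @fixed_point setT (fun k => 1 + k * q) r r01.
  rewrite fc'; apply: le_trans (nrmM _ _) _.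
  by rewrite mulrC ler_wpM2r ?nrm_ge0.
have k1 : (1 - q) * k = 1.
  have -> : (1 - q) * k = k - q * k by ncring.
  by rewrite {1}kE addrK.
have k1' : k' * (1 - q) = 1.
  have -> : k' * (1 - q) = k' - k' * q by ncring.
  by rewrite {1}kE' addrK.
have kk : k' = k by rewrite -[k']mulr1 -k1 mulrA k1' mul1r.
by exists k => //; rewrite -kk.
Qed.

Lemma comm_inv a k y : k * a = 1 -> a * k = 1 -> GRing.comm y a -> GRing.comm y k.
Proof.
rewrite /GRing.comm => ka ak ya.
by rewrite -[LHS]mul1r -ka mulrA -(mulrA k a) -ya -!mulrA ak mulr1.
Qed.

Lemma sa_inv a k : k * a = 1 -> a * k = 1 -> sa a -> sa k.
Proof.
rewrite /sa => ka ak sA.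
have : ustar k * a = 1 by rewrite -sA -ustarM ak ustar1.
by move=> h; rewrite -[LHS]mulr1 -ak mulrA h mul1r.
Qed.

(** * Commuting squares and the positive cone *)

(* [x + i y] is a multiple of a unitary. *)
Lemma nrm_sum_sq x y m : 0 <= m -> sa x -> sa y -> x * y = y * x ->
  x * x + y * y = m%:U -> nrm x ^+ 2 <= m.
Proof.
move=> m0 sx sy xy xym; pose w := x + imag * y.
have iy : ustar (imag * y) = - (imag * y) by rewrite ustarM sy ustar_imag mulrN imagC.
have sw : ustar w = x - imag * y by rewrite /w ustarD sx iy.
have w2 : nrm w ^+ 2 <= m.
  rewrite -nrm_star_mul sw /w.
  (* This identity holds in any ring; the last three terms contain commutators, which vanish by [xy]
     and the centrality of [imag]. *)
  have -> : (x - imag * y) * (x + imag * y) =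
     x * x - imag * (imag * (y * y)) + (x * imag - imag * x) * y + imag * (x * y - y * x)
     + imag * (imag * y - y * imag) * y by ncring.
  rewrite xy -!(imagC x) -!(imagC y) !subrr !(mulr0, mul0r) !addr0 mulrA imag2 mulN1r opprK xym.
  by rewrite (le_trans (nrm_embl _))// ger0_norm.
have xE : x = 2^-1%:U * (w + ustar w).
  rewrite sw /w; have -> : x + imag * y + (x - imag * y) = x + x by ncring.
  rewrite -{2 3}[x]mul1r -mulrDl -emb1 -embD mulrA -embM.
  have -> : 2^-1 * (1 + 1) = 1 :> R by lra.
  by rewrite emb1 mul1r.
apply: le_trans w2; rewrite ler_sqr ?nnegrE ?nrm_ge0//.
rewrite {1}xE nrm_emb ger0_norm ?invr_ge0//.
have := nrmD w (ustar w); rewrite nrm_star; lra.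
Qed.

(** Spectrum-free positivity: for self-adjoint [a], [|t - a| <= t] means that the spectrum lies in
    [[0, 2t]]. *)
Definition pos a := sa a /\ exists2 t, 0 <= t & nrm (t%:U - a) <= t.

Lemma pos_sa a : pos a -> sa a. Proof. by case. Qed.

Lemma posD a b : pos a -> pos b -> pos (a + b).
Proof.
move=> [sA [s s0 hs]] [sB [t t0 ht]]; split; first exact: saD.
exists (s + t); first exact: addr_ge0.
have -> : (s + t)%:U - (a + b) = (s%:U - a) + (t%:U - b) by rewrite embD; ncring.
by rewrite (le_trans (nrmD _ _))// lerD.
Qed.

Lemma posZ t a : 0 <= t -> pos a -> pos (t%:U * a).
Proof.
move=> t0 [sA [s s0 hs]]; split; first exact: saZ.
exists (t * s); first exact: mulr_ge0.
by rewrite embM -mulrBr nrm_emb ger0_norm// ler_wpM2l.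
Qed.

Lemma pos_nrm_sub a m : sa a -> nrm a <= m -> pos (m%:U - a).
Proof.
move=> sA am; have m0 := le_trans (nrm_ge0 a) am.
split; first exact/saB/sA/sa_emb.
by exists m => //; have -> : m%:U - (m%:U - a) = a by ncring.
Qed.

Lemma pos_emb t : 0 <= t -> pos t%:U.
Proof.
move=> t0; rewrite -[t%:U]subr0; apply: pos_nrm_sub; first exact: ustar0.
by rewrite nrm0.
Qed.

Lemma sq_scale r x : (r%:U * x) * (r%:U * x) = (r ^+ 2)%:U * (x * x).
Proof. by rewrite mulrA -(mulrA r%:U x) -embC !mulrA -embM expr2. Qed.

(** After scaling to [|y^2| <= 1/2], [1 - y^2] is the square of some [1 - q] commuting with [y]. The
    two squares sum to 1, so [nrm_sum_sq] gives [|1 - y^2| <= 1]. *)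
Lemma pos_sq (s : A) : sa s -> pos (s * s).
Proof.
move=> sS; pose N := 2 * (nrm s + 1).
have n0 := nrm_ge0 s.
have N0 : 0 < N by rewrite /N; lra.
pose y := (N^-1)%:U * s.
have sy : sa y by exact: saZ.
have ny : nrm y <= 2^-1.
  rewrite nrm_emb ger0_norm ?invr_ge0 ?(ltW N0)// mulrC ler_pdivrMr// /N; lra.
have nyy : nrm (y * y) <= 2^-1.
  rewrite nrm_sa2// expr2; apply: (@le_trans _ _ (2^-1 * 2^-1)); last lra.
  by rewrite ler_pM ?nrm_ge0.
have [|q [qs qr qc qE]] := @sqrt_sub1 (y * y) 2^-1 _ (sa_sq sy) nyy; first by lra.
have yq : GRing.comm y q by apply: qc; rewrite /GRing.comm mulrA.
have y1q : (1 - q) * y = y * (1 - q) by rewrite mulrBl mulrBr mul1r mulr1 yq.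
have q2 : (1 - q) * (1 - q) + y * y = 1%:U by rewrite qE subrK emb1.
have := nrm_sum_sq ler01 (saB sa1 qs) sy y1q q2.
have s1q : sa (1 - q) by exact: saB sa1 qs.
rewrite -nrm_sa2// qE => n1.
have -> : s * s = (N ^+ 2)%:U * (y * y).
  rewrite sq_scale mulrA -embM -exprMn mulfV ?gt_eqF// expr1n emb1 mul1r //.
apply: posZ; first by rewrite sqr_ge0.
by split; [exact: sa_sq|exists 1 => //; rewrite emb1].
Qed.

(** Here [a + e = (t + e)(1 - h)] with [|h| <= t/(t + e) < 1], so [inv_sub1] applies; [pos_sqrt]
    uses the same factorization. *)
Lemma pos_inv a e : 0 < e -> pos a ->
  exists k, [/\ sa k, k * (a + e%:U) = 1, (a + e%:U) * k = 1 & bicommutes a k].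
Proof.
move=> e0 [sA [t t0 ht]]; have te : 0 < t + e by lra.
pose h := ((t + e)^-1)%:U * (t%:U - a).
have hr : nrm h <= t / (t + e).
  by rewrite nrm_emb ger0_norm ?invr_ge0 ?(ltW te)// mulrC ler_wpM2r// invr_ge0 ltW.
have r01 : 0 <= t / (t + e) < 1.
  by rewrite divr_ge0 ?(ltW te)//= ltr_pdivrMr// mul1r; lra.
have aE : a + e%:U = (t + e)%:U * (1 - h).
  rewrite mulrBr mulr1 mulrA -embM mulfV ?gt_eqF// emb1 mul1r embD; ncring.
have [k k1 k2] := inv_sub1 r01 hr.
pose k' := ((t + e)^-1)%:U * k.
have k1' : k' * (a + e%:U) = 1.
  by rewrite aE embC /k' mulrA -(mulrA _ k) k1 mulr1 -embM mulVf ?gt_eqF// emb1.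
have k2' : (a + e%:U) * k' = 1.
  by rewrite aE /k' mulrA -(mulrA _ (1 - h)) -embC -!mulrA k2 mulr1 -embM mulfV ?gt_eqF// emb1.
exists k'; split => //.
- exact: (sa_inv k1' k2' (saD sA (sa_emb _))).
- by move=> y ya; apply: (comm_inv k1' k2'); apply: commrD => //; exact: comm_emb.
Qed.

Lemma pos_sqrt a e : 0 < e -> pos a ->
  exists s : A, [/\ sa s, pos s, s * s = a + e%:U & bicommutes a s].
Proof.
move=> e0 [sA [t t0 ht]]; have te : 0 < t + e by lra.
pose h := ((t + e)^-1)%:U * (t%:U - a).
have hr : nrm h <= t / (t + e).
  by rewrite nrm_emb ger0_norm ?invr_ge0 ?(ltW te)// mulrC ler_wpM2r// invr_ge0 ltW.
have r01 : 0 <= t / (t + e) < 1.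
  by rewrite divr_ge0 ?(ltW te)//= ltr_pdivrMr// mul1r; lra.
have aE : a + e%:U = (t + e)%:U * (1 - h).
  rewrite mulrBr mulr1 mulrA -embM mulfV ?gt_eqF// emb1 mul1r embD; ncring.
have sh : sa h by apply/saZ/saB/sA/sa_emb.
have [q [qs qr qc qE]] := sqrt_sub1 r01 sh hr.
have p1q : pos (1 - q).
  rewrite -emb1; apply: pos_nrm_sub => //; apply: le_trans qr _.
  by case/andP: r01 => _ /ltW.
exists ((Num.sqrt (t + e))%:U * (1 - q)); split.
- exact/saZ/saB/qs/sa1.
- by apply: posZ => //; exact: sqrtr_ge0.
- by rewrite sq_scale sqr_sqrtr ?(ltW te)// qE.
- move=> y ya; apply: commrM; first exact: comm_emb.
  apply: commrB; first exact: commr1.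
  apply: qc; apply: commrM; first exact: comm_emb.
  by apply: commrB => //; exact: comm_emb.
Qed.

(** Commuting roots of [a + e] and [m - a + e] have squares summing to [m + 2e], so [nrm_sum_sq]
    bounds [|a + e|]; then [e] tends to 0. *)
Lemma pos_nrm_le a m : pos a -> pos (m%:U - a) -> 0 <= m -> nrm a <= m.
Proof.
move=> pa pma m0; apply: le_add_eps => e0 e0_gt0.
pose e := e0 / 3; have e_gt0 : 0 < e by rewrite /e; lra.
have [s [ss _ sE sc]] := pos_sqrt e_gt0 pa.
have [t [st _ tE tc]] := pos_sqrt e_gt0 pma.
have ct : GRing.comm t a.
  by apply/commr_sym/tc/commrB => //; exact: comm_emb.
have stc : s * t = t * s by rewrite (sc _ ct).
have st2 : s * s + t * t = (m + e + e)%:U by rewrite sE tE !embD; ncring.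
have := nrm_sum_sq _ ss st stc st2.
rewrite -nrm_sa2// sE => /(_ ltac:(lra)) H.
have -> : a = a + e%:U - e%:U by ncring.
apply: le_trans (nrmB _ _) _.
have := nrm_embl e; rewrite (ger0_norm (ltW e_gt0)) /e in H *; lra.
Qed.

(** Any bound on the norm can serve as [t] in [pos]. This uniform choice makes the cone closed in
    [pos_approx]. *)
Lemma pos_nrm_sub_le a m : pos a -> nrm a <= m -> nrm (m%:U - a) <= m.
Proof.
move=> pa am; apply: pos_nrm_le (le_trans (nrm_ge0 _) am).
  by apply: pos_nrm_sub => //; exact: pos_sa.
by have -> : m%:U - (m%:U - a) = a by ncring.
Qed.

Lemma pos_antisym a : pos a -> pos (- a) -> a = 0.
Proof.
move=> pa na; apply: nrm_eq0; apply/eqP; rewrite eq_le nrm_ge0 andbT.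
by apply: pos_nrm_le => //; rewrite emb0 sub0r.
Qed.

Lemma pos_approx a : (forall e, 0 < e -> pos (a + e%:U)) -> pos a.
Proof.
move=> H.
have sA : sa a.
  have -> : a = a + 1%:U - 1%:U by ncring.
  by apply: saB (sa_emb _); apply: pos_sa; exact: H.
split => //; exists (nrm a); first exact: nrm_ge0.
apply: le_add_eps => e e0.
have e2 : 0 < e / 3 by lra.
have nae : nrm (a + (e / 3)%:U) <= nrm a + e / 3.
  apply: le_trans (nrmD _ _) _; rewrite lerD2l.
  by rewrite (le_trans (nrm_embl _))// ger0_norm// ltW.
have := pos_nrm_sub_le (H _ e2) nae.
have -> : (nrm a + e / 3)%:U - (a + (e / 3)%:U) = (nrm a)%:U - a by rewrite embD; ncring.
lra.
Qed.

(** Replacing [a] by the square [a + d] costs the term [d b^* b], which [e] absorbs for small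
    [d]. *)
Lemma pos_conj_sqrt a b : pos a ->
  (forall s : A, sa s -> bicommutes a s -> pos (ustar b * (s * s) * b)) ->
  pos (ustar b * a * b).
Proof.
move=> pa H; apply: pos_approx => e e0.
pose d := e / (nrm b ^+ 2 + 1).
have b1 : 0 < nrm b ^+ 2 + 1 by have := sqr_ge0 (nrm b); lra.
have d0 : 0 < d by rewrite divr_gt0.
have [s [ss _ sE sc]] := pos_sqrt d0 pa.
have -> : ustar b * a * b + e%:U =
    ustar b * (s * s) * b + (e%:U - d%:U * (ustar b * b)).
  rewrite sE mulrDr mulrDl -embC -!mulrA; ncring.
apply: posD; first exact: H.
apply: pos_nrm_sub; first exact/saZ/sa_star_mul.
rewrite nrm_emb ger0_norm ?(ltW d0)// nrm_star_mul /d mulrAC ler_pdivrMr//.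
by rewrite ler_wpM2l ?(ltW e0)//; lra.
Qed.

(** Commutation turns [b s^2 b] into the square [(b s)^2]. This case does not rest on
    [pos_star_mul], whose proof uses it. *)
Lemma pos_conj_comm a b : pos a -> sa b -> GRing.comm b a -> pos (b * a * b).
Proof.
move=> pa sb ba; rewrite -{1}sb; apply: pos_conj_sqrt => // s ss sc; rewrite sb.
have bs : b * s = s * b by exact: sc.
have -> : b * (s * s) * b = (b * s) * (b * s) + (b * s) * (s * b - b * s) by ncring.
by rewrite bs subrr mulr0 addr0; apply: pos_sq; apply: saM.
Qed.

(** * Positivity of [c^* c] *)

(* The quantitative content of [sp (c^* c) \ {0} = sp (c c^* ) \ {0}]. *)
Lemma nrm_small_of_opposite_signs c d : 0 < d ->
  pos (d%:U - ustar c * c) -> pos (c * ustar c + d%:U) -> nrm c ^+ 2 <= 8 * d.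
Proof.
move=> d0 pu pg; rewrite leNgt; apply/negP => m8.
pose m := nrm c ^+ 2; have m0 : 0 < m by rewrite /m; lra.
have [g [sg _ gE gc]] := pos_sqrt d0 pg.
have [k [sk k1 k2 kc]] := pos_inv m0 (pos_sq sg).
have gk : g * k = k * g by apply: kc; rewrite /GRing.comm mulrA.
have sgk : sa (k * g) by exact: saM.
(* Up to sign, [z] and [y] are the real and imaginary parts of the Cayley transform of [g / sqrt m],
   so their squares sum to 1. *)
pose y := (2 * Num.sqrt m)%:U * (k * g).
pose z := 1 - (2 * m)%:U * k.
have sy : sa y by exact: saZ.
have sz : sa z by exact/saB/saZ/sk/sa1.
have kkg : k * g * (k * g) = k - m%:U * (k * k).
  have -> : k * g * (k * g) = k * (g * g + m%:U) * k - k * m%:U * k + k * g * (k * g - g * k) by ncring.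
  by rewrite k1 gk subrr mulr0 addr0 mul1r -embC mulrA.
have yz : y * y + z * z = 1%:U.
  rewrite /y sq_scale kkg exprMn sqr_sqrtr ?(ltW m0)// /z.
  have -> : (1 - (2 * m)%:U * k) * (1 - (2 * m)%:U * k) =
     1 - ((2 * m)%:U * k + (2 * m)%:U * k) + (2 * m)%:U * k * ((2 * m)%:U * k) by ncring.
  rewrite sq_scale -mulrDl -embD mulrBr (mulrA _ m%:U) -embM emb1.
  have -> : 2 ^+ 2 * m * m = (2 * m) ^+ 2 by ring.
  have -> : 2 * m + 2 * m = 2 ^+ 2 * m by ring.
  ncring.
have yzc : y * z = z * y.
  have zk : GRing.comm z (k * g).
    apply/commr_sym/commrB; first exact: commr1.
    apply: commrM; first exact: comm_emb.
    by rewrite /GRing.comm -mulrA gk mulrA.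
  by apply/commr_sym/commrM => //; exact: comm_emb.
have ny := nrm_sum_sq ler01 sy sz yzc yz.
have nz : nrm z ^+ 2 <= 1.
  by apply: (nrm_sum_sq ler01 sz sy (esym yzc)); rewrite addrC.
have {}nz : nrm z <= 1 by rewrite -(@ler_sqr R) ?nnegrE ?nrm_ge0// expr1n.
have nk : nrm k * m <= 1.
  have : nrm ((2 * m)%:U * k) <= 2.
    have -> : (2 * m)%:U * k = 1 - z by rewrite /z; ncring.
    apply: le_trans (nrmB _ _) _; have := nrm1 (s := A); lra.
  by rewrite nrm_emb ger0_norm; last lra; lra.
have nkg : nrm (k * g) ^+ 2 * (4 * m) <= 1.
  apply: le_trans ny; rewrite /y nrm_emb ger0_norm ?mulr_ge0 ?sqrtr_ge0//.
  rewrite !exprMn sqr_sqrtr ?(ltW m0)//; lra.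
have nkc : nrm (k * c) ^+ 2 <= nrm (k * g) ^+ 2 + (2 * d) * nrm k ^+ 2.
  rewrite -nrm_mul_star ustarM sk.
  have -> : k * c * (ustar c * k) = k * (g * g) * k - (2 * d)%:U * (k * k).
    have -> : 2 * d = d + d by ring.
    have dk : d%:U * (k * k) = k * d%:U * k by rewrite mulrA embC.
    rewrite gE embD mulrDl dk; ncring.
  apply: le_trans (nrmB _ _) _; rewrite nrm_emb ger0_norm; last lra.
  have -> : k * (g * g) * k = k * g * (k * g) by rewrite -!mulrA gk.
  by rewrite !nrm_sa2.
(* Positivity of [d - c^* c] improves the trivial bound [2m] on [|m + c^* c|] to [m + d]; the
   contradiction comes from this gain. *)
have nu : nrm ((m + d)%:U - (d%:U - ustar c * c)) <= m + d.
  apply: pos_nrm_sub_le => //; apply: le_trans (nrmB _ _) _.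
  have := nrm_embl d; rewrite nrm_star_mul -/m (ger0_norm (ltW d0)); lra.
(* [k] inverts [c c^* + 2d + m], which moves past [c] as [c^* c + 2d + m]. *)
have cE : c = k * c * ((m + d)%:U - (d%:U - ustar c * c) + (2 * d)%:U).
  rewrite -[LHS]mul1r -k1 gE.
  have -> : 2 * d = d + d by ring.
  have -> : k * (c * ustar c + d%:U + d%:U + m%:U) * c =
      k * c * (ustar c * c) + k * (d%:U * c) + k * (d%:U * c) + k * (m%:U * c) by ncring.
  rewrite !embC !embD; ncring.
have nc : nrm c <= nrm (k * c) * (m + 3 * d).
  rewrite {1}cE; apply: le_trans (nrmM _ _) _; rewrite ler_wpM2l ?nrm_ge0//.
  apply: le_trans (nrmD _ _) _; have := nrm_embl (2 * d).
  rewrite ger0_norm; lra.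
(* With [d < m/8], the estimates combine to [m <= (1/2) (11/8)^2 m = (121/128) m]. *)
have d1 : d < m / 8 by rewrite ltr_pdivlMr// mulrC.
have nc2 : m <= nrm (k * c) ^+ 2 * (m + 3 * d) ^+ 2.
  by rewrite -exprMn ler_sqr ?nnegrE ?mulr_ge0 ?nrm_ge0//; lra.
have kk1 : (nrm k * m) ^+ 2 <= 1.
  by rewrite expr_le1// mulr_ge0 ?nrm_ge0// ltW.
have kc1 : nrm (k * c) ^+ 2 * m ^+ 2 <= m / 4 + 2 * d.
  have h1 : nrm (k * c) ^+ 2 * m ^+ 2 <= (nrm (k * g) ^+ 2 + 2 * d * nrm k ^+ 2) * m ^+ 2.
    by rewrite ler_wpM2r// sqr_ge0.
  apply: le_trans h1 _.
  have -> : (nrm (k * g) ^+ 2 + 2 * d * nrm k ^+ 2) * m ^+ 2 =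
     (nrm (k * g) ^+ 2 * (4 * m)) * (m / 4) + 2 * d * (nrm k * m) ^+ 2 by field.
  by apply: lerD; [rewrite ler_piMl//; lra|rewrite ler_piMr//; lra].
have kc2 : nrm (k * c) ^+ 2 * m ^+ 2 <= m / 2 by lra.
have md : (m + 3 * d) ^+ 2 <= (11 / 8 * m) ^+ 2 by rewrite ler_sqr ?nnegrE; lra.
have kc0 : 0 <= nrm (k * c) ^+ 2 by exact: sqr_ge0.
have : m <= nrm (k * c) ^+ 2 * (11 / 8 * m) ^+ 2.
  by apply: le_trans nc2 _; rewrite ler_wpM2l.
rewrite exprMn mulrCA; lra.
Qed.

(** Here [a] approximates the absolute value of [h], so [f = a - h] approximates twice its negative
    part. With [c = b f], [c^* c = f h f] is bounded above by a small [d], while [c c^* + c^* c] is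
    a sum of squares. Hence [c] is small, then [f], and [h + n = a + (n - f)] is positive. *)
Lemma pos_star_mul b : pos (ustar b * b).
Proof.
pose h := ustar b * b; have sh : sa h by exact: sa_star_mul.
pose F := 2 * nrm h + 1; have h0 := nrm_ge0 h.
have F1 : 1 <= F by rewrite /F; lra.
apply: pos_approx => n n0; rewrite -/h.
(* [e <= 1] yields [|a| <= |h| + 1], hence [|f| <= F]; the other bound serves the final estimate
   [|f|^4 <= 17 e F^2 <= n^4]. *)
pose e := Num.min 1 (n ^+ 4 / (17 * F ^+ 2)).
have F2 : 0 < 17 * F ^+ 2 by rewrite mulr_gt0// exprn_gt0//; lra.
have e0 : 0 < e by rewrite lt_min ltr01 divr_gt0 ?exprn_gt0.
have e1 : e <= 1 by rewrite ge_min lexx.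
have en : e * (17 * F ^+ 2) <= n ^+ 4 by rewrite -ler_pdivlMr// ge_min lexx orbT.
have [a [sA pa aE ac]] := pos_sqrt e0 (pos_sq sh).
have ah : a * h = h * a by apply/esym/ac; rewrite /GRing.comm mulrA.
pose f := a - h; have sf : sa f by exact: saB.
have nA : nrm a <= nrm h + 1.
  rewrite -(@ler_sqr R) ?nnegrE ?nrm_ge0//; last lra.
  rewrite -nrm_sa2// aE; apply: le_trans (nrmD _ _) _.
  have := nrm_embl e; rewrite nrm_sa2// (ger0_norm (ltW e0)) sqrrD; lra.
have nf : nrm f <= F by apply: le_trans (nrmB _ _) _; rewrite /F; lra.
have ffE : f * f = e%:U - h * f - h * f.
  have -> : f * f = (a * a - h * h) - h * f - h * f - (a * h - h * a) by rewrite /f; ncring.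
  by rewrite aE ah; ncring.
have hf : h * f = f * h by rewrite /f mulrBr mulrBl ah.
have ehf : ustar (b * f) * (b * f) = f * (h * f) by rewrite ustarM sf /h !mulrA.
have pf : pos f.
  have [k' [sk' _ k2' kc']] := pos_inv e0 (pos_sq sh).
  have k'h : GRing.comm h k' by apply: kc'; rewrite /GRing.comm mulrA.
  have k'a : GRing.comm a k' by apply: kc'; rewrite /GRing.comm mulrA ah -mulrA ah mulrA.
  pose k := a * k'; have ak : a * k = 1 by rewrite /k mulrA aE.
  have ka : k * a = 1 by rewrite /k -mulrA -k'a.
  have sk : sa k by exact: saM.
  have pk : pos k.
    by rewrite -[k]mul1r -ka; apply: pos_conj_comm => //; rewrite /GRing.comm ka.
  have fa : GRing.comm f a.
    by apply/commr_sym/commrB => //; exact: ah.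
  have kf : GRing.comm f k by exact: comm_inv ka ak fa.
  (* With [k] the inverse of [a], this rests on [f^2 + e = 2 f a]. All conjugations here are between
     commuting elements. *)
  have -> : f = 2^-1%:U * (f * k * f + e%:U * k).
    have -> : f * k * f + e%:U * k = (f * f + e%:U) * k + f * (k * f - f * k) by ncring.
    rewrite -kf subrr mulr0 addr0.
    have -> : f * f + e%:U = f * a + f * a.
      have -> : f * a = f * f + f * h by rewrite /f; ncring.
      have -> : e%:U = f * f + h * f + h * f by rewrite ffE; ncring.
      rewrite -hf; ncring.
    have -> : (f * a + f * a) * k = (1%:U + 1%:U) * (f * (a * k)) by rewrite emb1; ncring.
    rewrite ak mulr1 -embD mulrA -embM.
    have -> : 2^-1 * (1 + 1) = 1 :> R by lra.
    by rewrite emb1 mul1r.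
  apply: posZ; first by rewrite invr_ge0.
  by apply: posD; [apply: pos_conj_comm|apply: posZ => //; exact: ltW].
pose c := b * f; pose d := e * F.
have d0 : 0 < d by rewrite mulr_gt0//; lra.
(* Multiply [f^2 = e - 2 h f] by [f]. *)
have ccE : ustar c * c + ustar c * c = e%:U * f - f * f * f.
  rewrite /c ehf hf mulrA.
  have -> : f * f * h = f * (h * f) by rewrite -mulrA hf.
  have -> : f * f * f = f * (f * f) by rewrite mulrA.
  rewrite ffE embC; ncring.
have pfff : pos (f * f * f) by apply: pos_conj_comm.
have halfE x : x = 2^-1%:U * (x + x).
  rewrite -{2 3}[x]mul1r -mulrDl -emb1 -embD mulrA -embM.
  have -> : 2^-1 * (1 + 1) = 1 :> R by lra.
  by rewrite emb1 mul1r.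
have pd : pos (d%:U - ustar c * c).
  rewrite [X in pos X]halfE; apply: posZ; first by rewrite invr_ge0.
  have -> : d%:U - ustar c * c + (d%:U - ustar c * c) =
      d%:U + e%:U * (F%:U - f) + f * f * f.
    have -> : d%:U - ustar c * c + (d%:U - ustar c * c) =
       d%:U + d%:U - (ustar c * c + ustar c * c) by ncring.
    rewrite ccE {2}/d embM; ncring.
  apply: posD => //; apply: posD; first exact/pos_emb/ltW.
  by apply: posZ; [exact: ltW|exact: pos_nrm_sub].
have pcd : pos (c * ustar c + d%:U).
  (* Up to sign, [p] and [q] are twice the real and imaginary parts of [c], so [c c^* + c^* c] is
     half of [p^2 + q^2]. *)
  pose p := c + ustar c; pose q := imag * (c - ustar c).
  have sp : sa p by rewrite /sa /p ustarD ustarK addrC.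
  have sq : sa q.
    by rewrite /sa /q ustarM ustarB ustarK ustar_imag mulrN -mulNr opprB imagC.
  have qE : q * q = - ((c - ustar c) * (c - ustar c)).
    by rewrite /q {2}imagC mulrA -(mulrA imag) -imagC !mulrA imag2 -!mulrA mulN1r.
  have -> : c * ustar c + d%:U = 2^-1%:U * (p * p + q * q) + (d%:U - ustar c * c).
    rewrite qE /p.
    have -> : (c + ustar c) * (c + ustar c) - (c - ustar c) * (c - ustar c) =
      (c * ustar c + ustar c * c) + (c * ustar c + ustar c * c) by ncring.
    rewrite -halfE; ncring.
  by apply: posD => //; apply: posZ; [rewrite invr_ge0|apply: posD; exact: pos_sq].
have nc := nrm_small_of_opposite_signs d0 pd pcd.
have nfff : nrm (f * f * f) <= 17 * d.
  have -> : f * f * f = e%:U * f - (ustar c * c + ustar c * c) by rewrite ccE; ncring.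
  apply: le_trans (nrmB _ _) _; rewrite nrm_emb (ger0_norm (ltW e0)).
  apply: (@le_trans _ _ (e * F + (8 * d + 8 * d))); last by rewrite /d; lra.
  apply: lerD; first by rewrite ler_wpM2l// ltW.
  by apply: le_trans (nrmD _ _) _; rewrite nrm_star_mul lerD.
have nfn : nrm f <= n.
  rewrite -(@ler_pXn2r _ 4) ?nnegrE ?nrm_ge0// ?(ltW n0)//.
  apply: le_trans en.
  have -> : nrm f ^+ 4 = nrm (f * f * f * f).
    by rewrite -mulrA nrm_sa2 ?nrm_sa2 -?exprM//; exact: sa_sq.
  apply: le_trans (nrmM _ _) _.
  have -> : e * (17 * F ^+ 2) = (17 * d) * F by rewrite /d; ring.
  by rewrite ler_pM ?nrm_ge0.
have -> : h + n%:U = a + (n%:U - f) by rewrite /f; ncring.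
by apply: posD => //; exact: pos_nrm_sub.
Qed.

Lemma pos_conj a b : pos a -> pos (ustar b * a * b).
Proof.
move=> pa; apply: pos_conj_sqrt => // s ss _.
have -> : ustar b * (s * s) * b = ustar (s * b) * (s * b) by rewrite ustarM ss !mulrA.
exact: pos_star_mul.
Qed.

End Unital.

Local Notation "t %:U" := (emb t) (at level 2, format "t %:U").

(** * The multiplier algebra *)

Section RealNorm.
Context {R : realType} {V : normedModType R[i]}.
Implicit Types x y : V.

(** Norms take values in [R[i]], whose order is partial; the real part lets them be compared in
    [R]. *)
Definition rn x : R := complex.Re `|x|.

Lemma rnE x : `|x| = (rn x)%:C%C.
Proof. by rewrite /rn RRe_real// normr_real. Qed.
Lemma rn_ge0 x : 0 <= rn x. Proof. by rewrite -ler0c -rnE normr_ge0. Qed.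
Lemma rnD x y : rn (x + y) <= rn x + rn y.
Proof. by rewrite -lecR rmorphD/= -!rnE ler_normD. Qed.
Lemma rnN x : rn (- x) = rn x. Proof. by rewrite /rn normrN. Qed.
Lemma rnB x y : rn (x - y) <= rn x + rn y. Proof. by rewrite -[rn y]rnN rnD. Qed.
Lemma rn_distC x y : rn (x - y) = rn (y - x). Proof. by rewrite /rn distrC. Qed.
Lemma rn0 : rn (0 : V) = 0. Proof. by rewrite /rn normr0. Qed.
Lemma rn_eq0 x : rn x = 0 -> x = 0.
Proof. by move=> x0; apply/eqP; rewrite -normr_eq0 rnE x0. Qed.
Lemma rn_approx0 x : (forall e, 0 < e -> rn x <= e) -> x = 0.
Proof.
move=> H; apply: rn_eq0; apply/eqP; rewrite eq_le rn_ge0 andbT.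
by apply/ler_addgt0Pr => e e0; rewrite add0r H.
Qed.
Lemma rnZ (k : R[i]) x : rn (k *: x) = complex.Re `|k| * rn x.
Proof.
by apply: complexI; rewrite -rnE normrZ rmorphM/= -!rnE.
Qed.
Lemma rnZr (t : R) x : rn (t%:C%C *: x) = `|t| * rn x.
Proof. by rewrite rnZ normc_def /= expr0n addr0 sqrtr_sqr. Qed.

End RealNorm.

(** * Geometrically convergent sequences *)

Section Geometric.
Context {R : realType}.

Lemma geometric_small (C r e : R) : 0 <= r < 1 -> 0 < e ->
  exists N, forall n, (N <= n)%N -> C * r ^+ n <= e.
Proof.
move=> /andP[r0 r1] e0.
have /cvgrPdist_le /(_ e e0)[N _ HN] : (fun n => C * r ^+ n) @ \oo --> (0 : R).
  by have := @cvg_geometric R C r; rewrite ger0_norm// => /(_ r1).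
exists N => n Nn; have := HN n Nn; rewrite /= sub0r normrN.
exact: le_trans (ler_norm _).
Qed.

(** With [D = C / (1 - r)], the increments telescope to [D r^n - D r^(n + k)]; completeness provides
    the limit and the rate survives. *)
Lemma geometric_lim (V : completeNormedModType R[i]) (x : nat -> V) (C r : R) :
  0 <= r < 1 -> (forall n, rn (x n.+1 - x n) <= C * r ^+ n) ->
  exists l, forall n, rn (x n - l) <= C / (1 - r) * r ^+ n.
Proof.
move=> r01 xC; have /andP[r0 r1] := r01.
have C0 : 0 <= C by have := xC 0%N; rewrite expr0 mulr1; apply: le_trans; exact: rn_ge0.
have r1' : 0 < 1 - r by lra.
have D0 : 0 <= C / (1 - r) by rewrite divr_ge0// ltW.
have DE : C / (1 - r) - C / (1 - r) * r = C by field; rewrite gt_eqF.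
set D := C / (1 - r) in D0 DE *.
have xd n k : rn (x (n + k)%N - x n) <= D * r ^+ n - D * r ^+ (n + k).
  elim: k => [|k IH]; first by rewrite addn0 !subrr rn0.
  have -> : x (n + k.+1)%N - x n = (x (n + k).+1 - x (n + k)%N) + (x (n + k)%N - x n).
    by rewrite addnS addrA subrK.
  apply: le_trans (rnD _ _) _.
  have h := xC (n + k)%N.
  have -> : D * r ^+ n - D * r ^+ (n + k.+1) =
      C * r ^+ (n + k) + (D * r ^+ n - D * r ^+ (n + k)).
    by rewrite addnS exprS -[in RHS]DE; ring.
  lra.
have xd' n k : (n <= k)%N -> rn (x k - x n) <= D * r ^+ n.
  move=> nk; have := xd n (k - n)%N; rewrite subnKC//.
  have : 0 <= D * r ^+ k by rewrite mulr_ge0// exprn_ge0.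
  lra.
have /cauchy_cvgP cx : cauchy (x @ \oo).
  apply/cauchy_ballP => e e0.
  have eE : e = (complex.Re e)%:C%C by rewrite RRe_real// gtr0_real.
  have re0 : 0 < complex.Re e by rewrite -ltcR -eE.
  have [N HN] := geometric_small D r01 (divr_gt0 re0 (ltr0n R 3)).
  exists ([set x n | n in [set n | N <= n]%N], [set x n | n in [set n | N <= n]%N]).
    by split; exists N => // n /= Nn; exists n.
  move=> [_ _] /= [[n Nn <-] [k Nk <-]].
  rewrite -ball_normE /= rnE eE ltcR.
  have -> : x n - x k = (x n - x N) - (x k - x N) by rewrite opprB addrA subrK.
  apply: le_lt_trans (rnB _ _) _.
  have := xd' _ _ Nn; have := xd' _ _ Nk; have := HN _ (leqnn N); lra.
have /cvgrPdist_lt cl := cx.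
exists (lim (x @ \oo)) => n; apply/ler_addgt0Pr => e e0.
have [N _ HN] : \forall n \near \oo, `|lim (x @ \oo) - x n| < e%:C%C.
  by apply: cl; rewrite ltcR.
have /= := HN (maxn N n) (leq_maxl _ _); rewrite rnE ltcR => h.
have -> : x n - lim (x @ \oo) =
    - (x (maxn N n) - x n) - (lim (x @ \oo) - x (maxn N n)).
  by rewrite !opprB addrA subrK.
apply: le_trans (rnB _ _) _; rewrite rnN.
by apply: lerD; [exact/xd'/leq_maxr|exact: ltW].
Qed.

End Geometric.

(** * Calculus in a nonunital C*-algebra *)

Section CStar.
Context {R : realType} {B : cstarAlgType R}.
Implicit Types a b x y : B.

Lemma rnM x y : rn (cmul x y) <= rn x * rn y.
Proof. by rewrite -lecR rmorphM/= -!rnE cnormM. Qed.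
Lemma rn_star_mul x : rn (cmul (cstar x) x) = rn x ^+ 2.
Proof. by apply: complexI; rewrite rmorphXn/= -!rnE cnorm_star_mul. Qed.
Lemma cmul0l x : cmul 0 x = 0.
Proof. by rewrite -[X in cmul X _](scale0r (0 : B)) cmulZl scale0r. Qed.
Lemma cmul0r x : cmul x 0 = 0.
Proof. by rewrite -[X in cmul _ X](scale0r (0 : B)) cmulZr scale0r. Qed.
Lemma cmulNl x y : cmul (- x) y = - cmul x y.
Proof. by rewrite -scaleN1r cmulZl scaleN1r. Qed.
Lemma cmulNr x y : cmul x (- y) = - cmul x y.
Proof. by rewrite -scaleN1r cmulZr scaleN1r. Qed.
Lemma cmulBl x y z : cmul (x - y) z = cmul x z - cmul y z.
Proof. by rewrite cmulDl cmulNl. Qed.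
Lemma cmulBr x y z : cmul x (y - z) = cmul x y - cmul x z.
Proof. by rewrite cmulDr cmulNr. Qed.
Lemma cstarN x : cstar (- x) = - cstar x.
Proof. by rewrite -scaleN1r cstarZ rmorphN rmorph1 scaleN1r. Qed.
Lemma cstarB x y : cstar (x - y) = cstar x - cstar y.
Proof. by rewrite cstarD cstarN. Qed.
Lemma cstarZr (t : R) x : cstar (t%:C%C *: x) = t%:C%C *: cstar x.
Proof. by rewrite cstarZ conj_Creal// complex_real. Qed.
Lemma cstar0 : cstar (0 : B) = 0.
Proof. by rewrite -[X in cstar X](scale0r (0 : B)) cstarZ rmorph0 scale0r. Qed.

Lemma rn_cstar x : rn (cstar x) = rn x.
Proof.
suff le y : rn y <= rn (cstar y).
  by apply/eqP; rewrite eq_le le -{2}[x]cstarK le.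
have [y0|y0] := eqVneq (rn y) 0; first by rewrite y0 rn_ge0.
rewrite -(@ler_pM2r _ (rn y)) ?lt_def ?y0 ?rn_ge0// -expr2 -rn_star_mul.
exact: rnM.
Qed.

Lemma cstar_mul_eq0 x : cmul (cstar x) x = 0 -> x = 0.
Proof.
move=> h; apply/rn_eq0/eqP; rewrite -sqrf_eq0 -rn_star_mul h.
by rewrite rn0.
Qed.

(** Stands in for evaluation at a unit: take [z = x - y] and use the C*-identity. *)
Lemma cstar_mul_inj x y :
  (forall z, cmul (cstar x) z = cmul (cstar y) z) -> x = y.
Proof.
move=> H; apply/eqP; rewrite -subr_eq0; apply/eqP/cstar_mul_eq0.
by rewrite cstarB cmulBl H subrr.
Qed.

Lemma cmul_inj x y : (forall z, cmul (cstar z) x = cmul (cstar z) y) -> x = y.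
Proof.
move=> H; apply/eqP; rewrite -subr_eq0; apply/eqP/cstar_mul_eq0.
by rewrite cmulBr H subrr.
Qed.

End CStar.

(** Multipliers are the adjointable operators of [B] as a Hilbert module over itself, with inner
    product [x^* y]. Boundedness is recorded so that the operator norm is a finite supremum. *)
Record multiplier (R : realType) (B : cstarAlgType R) := Multiplier {
  mfun :> B -> B;
  madj : B -> B;
  madjP : forall x y, cmul (cstar (mfun x)) y = cmul (cstar x) (madj y);
  mbounded : exists C : R, forall x, rn (mfun x) <= C * rn x
}.

Section Multiplier.
Context {R : realType} {B : cstarAlgType R}.
Notation M := (multiplier B).
Implicit Types (S T : M) (x y z : B).

HB.instance Definition _ := gen_eqMixin M.
HB.instance Definition _ := gen_choiceMixin M.

Lemma madjP' T x y : cmul (cstar (madj T x)) y = cmul (cstar x) (T y).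
Proof. by rewrite -[LHS]cstarK cstarM cstarK -madjP cstarM cstarK. Qed.

Lemma mult_ext S T : S =1 T -> S = T.
Proof.
move=> ST; have ST' : madj S =1 madj T.
  by move=> y; apply: cmul_inj => z; rewrite -!madjP ST.
case: S T ST ST' => [f f' p b] [g g' p' b'] /= /funext fg /funext fg'.
by rewrite -{}fg -{}fg' in p' b' *; congr Multiplier; exact: Prop_irrelevance.
Qed.

(** Having an adjoint forces linearity, as testing against all [z] shows. *)
Lemma multD T x y : T (x + y) = T x + T y.
Proof. by apply: cstar_mul_inj => z; rewrite cstarD cmulDl !madjP cstarD cmulDl. Qed.
Lemma multZ T (k : R[i]) x : T (k *: x) = k *: T x.
Proof. by apply: cstar_mul_inj => z; rewrite cstarZ cmulZl !madjP cstarZ cmulZl. Qed.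
Lemma mult0 T : T 0 = 0.
Proof. by rewrite -[X in T X](scale0r (0 : B)) multZ scale0r. Qed.

(** * Operator norms of multipliers *)

Lemma bounded_ge0 (f : B -> B) : (exists C : R, forall x, rn (f x) <= C * rn x) ->
  exists2 C : R, 0 <= C & forall x, rn (f x) <= C * rn x.
Proof.
move=> [C HC]; exists `|C| => // x; apply: le_trans (HC x) _.
by rewrite ler_wpM2r ?rn_ge0// ler_norm.
Qed.

(** [|T^* x|^2 = |x^* T T^* x| <= C |x| |T^* x|], and one factor cancels. *)
Lemma madj_le T (C : R) : 0 <= C -> (forall x, rn (T x) <= C * rn x) ->
  forall x, rn (madj T x) <= C * rn x.
Proof.
move=> C0 HC x; have [y0|y0] := eqVneq (rn (madj T x)) 0.
  by rewrite y0 mulr_ge0 ?rn_ge0.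
rewrite -(@ler_pM2r _ (rn (madj T x))) ?lt_def ?y0 ?rn_ge0// -expr2 -rn_star_mul.
rewrite madjP'; apply: le_trans (rnM _ _) _; rewrite rn_cstar mulrAC mulrC.
by rewrite ler_wpM2r ?rn_ge0.
Qed.

Definition mult_norm T : R := sup [set rn (T x) | x in [set x | rn x <= 1]].

Lemma mult_norm_has_sup T : has_sup [set rn (T x) | x in [set x | rn x <= 1]].
Proof.
split; first by exists (rn (T 0)), 0 => //=; rewrite rn0.
have [C C0 HC] := bounded_ge0 (mbounded T).
exists C => _ [x /= x1 <-]; apply: le_trans (HC x) _.
by rewrite ler_piMr.
Qed.

Lemma mult_norm_ge0 T : 0 <= mult_norm T.
Proof.
apply: (le_trans (rn_ge0 (T 0))); apply: sup_upper_bound; last by exists 0 => //=; rewrite rn0.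
exact: mult_norm_has_sup.
Qed.

Lemma rn_mult_le T x : rn (T x) <= mult_norm T * rn x.
Proof.
have [x0|x0] := eqVneq (rn x) 0; first by rewrite (rn_eq0 x0) mult0 rn0 mulr0.
have xp : 0 < rn x by rewrite lt_def x0 rn_ge0.
have : rn (T ((rn x)^-1%:C%C *: x)) <= mult_norm T.
  apply: sup_upper_bound; first exact: mult_norm_has_sup.
  by exists ((rn x)^-1%:C%C *: x) => //=; rewrite rnZr ger0_norm ?invr_ge0 ?(ltW xp)// mulVf.
by rewrite multZ rnZr ger0_norm ?invr_ge0 ?(ltW xp)// mulrC ler_pdivrMr.
Qed.

Lemma mult_norm_le T (C : R) : 0 <= C -> (forall x, rn (T x) <= C * rn x) ->
  mult_norm T <= C.
Proof.
move=> C0 HC; apply: sup_le_ub; first by case: (mult_norm_has_sup T).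
move=> _ [x /= x1 <-]; apply: le_trans (HC x) _.
by rewrite ler_piMr.
Qed.

(** This and the next constructions are transparent, so that pointwise identities between
    multipliers hold by computation. *)
Definition mult_zero : M.
Proof.
apply: (@Multiplier R B (fun=> 0) (fun=> 0)) => [x y|].
  by rewrite cstar0 cmul0l cmul0r.
by exists 0 => x; rewrite rn0 mul0r.
Defined.

Definition mult_one : M.
Proof. by apply: (@Multiplier R B id id) => //; exists 1 => x; rewrite mul1r. Defined.

Definition mult_opp T : M.
Proof.
apply: (@Multiplier R B (fun x => - T x) (fun x => - madj T x)) => [x y|].
  by rewrite cstarN cmulNl madjP cmulNr.
by have [C HC] := mbounded T; exists C => x; rewrite rnN.
Defined.

Definition mult_add S T : M.
Proof.
apply: (@Multiplier R B (fun x => S x + T x) (fun x => madj S x + madj T x)) => [x y|].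
  by rewrite cstarD cmulDl !madjP cmulDr.
have [C HC] := mbounded S; have [D HD] := mbounded T.
exists (C + D) => x; apply: le_trans (rnD _ _) _; rewrite mulrDl; exact: lerD.
Defined.

Definition mult_mul S T : M.
Proof.
apply: (@Multiplier R B (S \o T) (madj T \o madj S)) => [x y|].
  by rewrite /= !madjP.
exists (mult_norm S * mult_norm T) => x /=; apply: le_trans (rn_mult_le _ _) _.
by rewrite -mulrA ler_wpM2l ?mult_norm_ge0// rn_mult_le.
Defined.

Definition mult_adj T : M.
Proof.
apply: (@Multiplier R B (madj T) T); first exact: madjP'.
by exists (mult_norm T); apply: madj_le; [exact: mult_norm_ge0|exact: rn_mult_le].
Defined.

Definition mult_scale (k : R[i]) : M.
Proof.
apply: (@Multiplier R B (fun x => k *: x) (fun x => k^* *: x)) => [x y|].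
  by rewrite cstarZ cmulZl cmulZr.
by exists (complex.Re `|k|) => x; rewrite rnZ.
Defined.

Definition mult_left (b : B) : M.
Proof.
apply: (@Multiplier R B (cmul b) (cmul (cstar b))) => [x y|].
  by rewrite cstarM cmulA.
by exists (rn b) => x; exact: rnM.
Defined.

(** * The ring of multipliers *)

Fact mult_addA : associative mult_add.
Proof. by move=> ? ? ?; apply: mult_ext => x /=; rewrite addrA. Qed.
Fact mult_addC : commutative mult_add.
Proof. by move=> ? ?; apply: mult_ext => x /=; rewrite addrC. Qed.
Fact mult_add0 : left_id mult_zero mult_add.
Proof. by move=> ?; apply: mult_ext => x /=; rewrite add0r. Qed.
Fact mult_addN : left_inverse mult_zero mult_opp mult_add.
Proof. by move=> ?; apply: mult_ext => x /=; rewrite addNr. Qed.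
Fact mult_mulA : associative mult_mul.
Proof. by move=> ? ? ?; apply: mult_ext. Qed.
Fact mult_mul1l : left_id mult_one mult_mul.
Proof. by move=> ?; apply: mult_ext. Qed.
Fact mult_mul1r : right_id mult_one mult_mul.
Proof. by move=> ?; apply: mult_ext. Qed.
Fact mult_mulDl : left_distributive mult_mul mult_add.
Proof. by move=> ? ? ?; apply: mult_ext. Qed.
Fact mult_mulDr : right_distributive mult_mul mult_add.
Proof. by move=> ? ? ?; apply: mult_ext => x /=; rewrite multD. Qed.

HB.instance Definition _ := GRing.isPzRing.Build M
  mult_addA mult_addC mult_add0 mult_addN mult_mulA mult_mul1l mult_mul1r
  mult_mulDl mult_mulDr.

(** * The C*-norm on multipliers and its completeness *)

Lemma mult_normM S T : mult_norm (S * T) <= mult_norm S * mult_norm T.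
Proof.
apply: mult_norm_le => [|x]; first by rewrite mulr_ge0 ?mult_norm_ge0.
apply: le_trans (rn_mult_le S (T x)) _.
by rewrite -mulrA ler_wpM2l ?mult_norm_ge0// rn_mult_le.
Qed.

Lemma mult_normD S T : mult_norm (S + T) <= mult_norm S + mult_norm T.
Proof.
apply: mult_norm_le => [|x]; first by rewrite addr_ge0 ?mult_norm_ge0.
apply: le_trans (rnD (S x) (T x)) _; rewrite mulrDl; apply: lerD; exact: rn_mult_le.
Qed.

Lemma mult_norm_eq0 T : mult_norm T = 0 -> T = 0.
Proof.
move=> T0; apply: mult_ext => x; apply/rn_eq0/eqP; rewrite eq_le rn_ge0 andbT.
by have := rn_mult_le T x; rewrite T0 mul0r.
Qed.

Lemma mult_norm_adj T : mult_norm (mult_adj T) = mult_norm T.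
Proof.
suff le U : mult_norm (mult_adj U) <= mult_norm U.
  apply/eqP; rewrite eq_le le.
  have adjK : mult_adj (mult_adj T) = T by exact: mult_ext.
  by rewrite -{1}adjK le.
apply: mult_norm_le; first exact: mult_norm_ge0.
by apply: madj_le; [exact: mult_norm_ge0|exact: rn_mult_le].
Qed.

(** The lower bound comes from [|T x|^2 = |x^* T^* T x| <= |T^* T| |x|^2]. *)
Lemma mult_norm_adj_mul T : mult_norm (mult_adj T * T) = mult_norm T ^+ 2.
Proof.
apply/eqP; rewrite eq_le; apply/andP; split.
  by apply: le_trans (mult_normM _ _) _; rewrite mult_norm_adj.
have n0 := mult_norm_ge0 (mult_adj T * T).
rewrite -(sqr_sqrtr n0) ler_sqr ?nnegrE ?mult_norm_ge0 ?sqrtr_ge0//.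
apply: mult_norm_le => [|x]; first exact: sqrtr_ge0.
rewrite -ler_sqr ?nnegrE ?mulr_ge0 ?sqrtr_ge0 ?rn_ge0//.
rewrite exprMn sqr_sqrtr// -rn_star_mul madjP.
apply: le_trans (rnM _ _) _; rewrite rn_cstar mulrC expr2 mulrA ler_wpM2r ?rn_ge0//.
exact: (rn_mult_le (mult_adj T * T)).
Qed.

Lemma mult_norm_scale (t : R) T :
  mult_norm (mult_scale t%:C%C * T) = `|t| * mult_norm T.
Proof.
have le (u : R) (U : M) : mult_norm (mult_scale u%:C%C * U) <= `|u| * mult_norm U.
  apply: mult_norm_le => [|x]; first by rewrite mulr_ge0 ?mult_norm_ge0.
  by rewrite /= rnZr -mulrA ler_wpM2l// rn_mult_le.
apply/eqP; rewrite eq_le le /=.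
have [->|t0] := eqVneq t 0; first by rewrite normr0 mul0r mult_norm_ge0.
rewrite -ler_pdivlMl ?normr_gt0// -normfV.
have {1}-> : T = mult_scale (t^-1)%:C%C * (mult_scale t%:C%C * T).
  by apply: mult_ext => x /=; rewrite scalerA -rmorphM mulVf// scale1r.
exact: le.
Qed.

(** Pointwise limits of [u n] and of its adjoints come with a rate proportional to [|x|]; this rate
    passes the adjoint relation to the limits and gives convergence in norm. *)
Lemma mult_norm_complete (u : nat -> M) (C r : R) : 0 <= r < 1 ->
  (forall n, mult_norm (u n.+1 - u n) <= C * r ^+ n) ->
  exists l, forall e, 0 < e -> exists N, forall n, (N <= n)%N ->
    mult_norm (u n - l) <= e.
Proof.
move=> r01 uC; have /andP[r0 r1] := r01.
have C0 : 0 <= C.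
  by have := uC 0%N; rewrite expr0 mulr1; apply: le_trans; exact: mult_norm_ge0.
have D0 : 0 <= C / (1 - r) by rewrite divr_ge0// subr_ge0 ltW.
have limP (v : nat -> M) :
    (forall n, mult_norm (v n.+1 - v n) <= C * r ^+ n) ->
    exists f : B -> B, forall x n, rn (v n x - f x) <= C / (1 - r) * r ^+ n * rn x.
  move=> vC; suff H : forall x, exists y, forall n,
    rn (v n x - y) <= C / (1 - r) * r ^+ n * rn x by have [f Hf] := choice H; exists f.
  move=> x; have [|y Hy] := @geometric_lim R B (fun n => v n x) (C * rn x) r r01.
    move=> n; apply: le_trans (rn_mult_le (v n.+1 - v n) x) _.
    by rewrite mulrAC ler_wpM2r ?rn_ge0.
  exists y => n; apply: le_trans (Hy n) _; rewrite le_eqVlt; apply/orP; left.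
  by apply/eqP; ring.
have [f Hf] := limP u uC.
have [|f' Hf'] := limP (fun n => mult_adj (u n)).
  move=> n; have -> : mult_adj (u n.+1) - mult_adj (u n) = mult_adj (u n.+1 - u n).
    exact: mult_ext.
  by rewrite mult_norm_adj.
have fP x y : cmul (cstar (f x)) y = cmul (cstar x) (f' y).
  apply/eqP; rewrite -subr_eq0; apply/eqP/rn_approx0 => e e0.
  have [N HN] := geometric_small (2 * (C / (1 - r) * rn x * rn y)) r01 e0.
  have -> : cmul (cstar (f x)) y - cmul (cstar x) (f' y) =
    cmul (cstar x) (mult_adj (u N) y - f' y) - cmul (cstar (u N x - f x)) y.
    by rewrite cmulBr cstarB cmulBl madjP /= opprB [RHS]addrC addrA subrK.
  apply: le_trans (HN _ (leqnn N)); apply: le_trans (rnB _ _) _.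
  apply: le_trans (lerD (rnM _ _) (rnM _ _)) _; rewrite !rn_cstar.
  have h1 : rn x * rn (mult_adj (u N) y - f' y) <= rn x * (C / (1 - r) * r ^+ N * rn y).
    by rewrite ler_wpM2l ?rn_ge0.
  have h2 : rn (u N x - f x) * rn y <= C / (1 - r) * r ^+ N * rn x * rn y.
    by rewrite ler_wpM2r ?rn_ge0.
  apply: le_trans (lerD h1 h2) _; rewrite le_eqVlt; apply/orP; left.
  by apply/eqP; ring.
have fb : exists D : R, forall x, rn (f x) <= D * rn x.
  exists (mult_norm (u 0%N) + C / (1 - r)) => x.
  have -> : f x = u 0%N x - (u 0%N x - f x) by rewrite opprB addrC subrK.
  apply: le_trans (rnB _ _) _; rewrite mulrDl; apply: lerD; first exact: rn_mult_le.
  by have := Hf x 0%N; rewrite expr0 mulr1.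
exists (Multiplier fP fb) => e e0; have [N HN] := geometric_small (C / (1 - r)) r01 e0.
exists N => n Nn; apply: le_trans (HN n Nn).
by apply: mult_norm_le => [|x]; [rewrite mulr_ge0 ?exprn_ge0|exact: Hf].
Qed.

Fact mult_scaleB : {morph (fun t : R => mult_scale t%:C%C) : s t / s - t >-> s - t : M}.
Proof. by move=> s t; apply: mult_ext => x /=; rewrite rmorphB scalerBl. Qed.
Fact mult_scaleM : {morph (fun t : R => mult_scale t%:C%C) : s t / s * t >-> s * t : M}.
Proof. by move=> s t; apply: mult_ext => x /=; rewrite rmorphM scalerA. Qed.
Fact mult_scale1 : mult_scale (1 : R)%:C%C = 1.
Proof. by apply: mult_ext => x /=; rewrite scale1r. Qed.
Fact mult_scaleC (k : R[i]) T : mult_scale k * T = T * mult_scale k.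
Proof. by apply: mult_ext => x /=; rewrite multZ. Qed.
Fact mult_adjK : involutive mult_adj.
Proof. by move=> T; exact: mult_ext. Qed.
Fact mult_adjB : {morph mult_adj : S T / S - T}.
Proof. by move=> S T; exact: mult_ext. Qed.
Fact mult_adjM S T : mult_adj (S * T) = mult_adj T * mult_adj S.
Proof. exact: mult_ext. Qed.
Fact mult_adj_scale (t : R) : mult_adj (mult_scale t%:C%C) = mult_scale t%:C%C.
Proof. by apply: mult_ext => x /=; rewrite conj_Creal// complex_real. Qed.
Fact mult_i2 : mult_scale 'i * mult_scale 'i = - 1.
Proof. by apply: mult_ext => x /=; rewrite scalerA -expr2 sqrCi scaleN1r. Qed.
Fact mult_adj_i : mult_adj (mult_scale 'i) = - mult_scale 'i.
Proof. by apply: mult_ext => x /=; rewrite conjCi scaleNr. Qed.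
Fact mult_norm1 : mult_norm 1 <= 1.
Proof. by apply: mult_norm_le => // x; rewrite mul1r. Qed.

HB.instance Definition _ := isUnitalCStar.Build R M
  mult_scaleB mult_scaleM mult_scale1 (fun t => mult_scaleC t%:C%C)
  mult_adjK mult_adjB mult_adjM mult_adj_scale (mult_scaleC 'i) mult_i2
  mult_adj_i mult_norm_ge0 mult_norm_eq0 mult_normD mult_normM mult_norm_scale
  mult_norm1 mult_norm_adj_mul mult_norm_complete.

End Multiplier.

(** * Hilbert modules and partial isometries *)

Section CStarOrder.
Context {R : realType} {B : cstarAlgType R}.
Implicit Types a b x y : B.

(** The order of [B] is read off in the unital multiplier algebra, into which left multiplication
    embeds [B]. *)
Definition bpos b := pos (mult_left b : multiplier B).

Lemma mult_leftB a b : mult_left (a - b) = mult_left a - mult_left b.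
Proof. by apply: mult_ext => x /=; rewrite cmulBl. Qed.
Lemma mult_leftM a b : mult_left (cmul a b) = mult_left a * mult_left b.
Proof. by apply: mult_ext => x /=; rewrite cmulA. Qed.
Lemma mult_left_star a : ustar (mult_left a) = mult_left (cstar a) :> multiplier B.
Proof. exact: mult_ext. Qed.
Lemma mult_leftZ (t : R) a :
  mult_left (t%:C%C *: a) = t%:U * mult_left a :> multiplier B.
Proof. by apply: mult_ext => x /=; rewrite cmulZl. Qed.
Lemma mult_left_inj : injective (@mult_left R B).
Proof.
move=> a b ab; apply: (can_inj cstarK); apply: cstar_mul_inj => z.
by rewrite !cstarK; exact: (congr1 (fun T : multiplier B => T z) ab).
Qed.

Lemma bpos_star_mul b : bpos (cmul (cstar b) b).
Proof. by rewrite /bpos mult_leftM -mult_left_star; exact: pos_star_mul. Qed.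

Lemma mult_left0 : mult_left (0 : B) = 0.
Proof. by rewrite -[X in mult_left X](subrr (0 : B)) mult_leftB subrr. Qed.

Lemma bpos_antisym b : bpos b -> bpos (- b) -> b = 0.
Proof.
rewrite /bpos => pb; rewrite -sub0r mult_leftB.
rewrite mult_left0 sub0r => nb; apply: mult_left_inj.
by rewrite mult_left0; exact: pos_antisym.
Qed.

End CStarOrder.

Section HilbertModule.
Context {R : realType} {B : cstarAlgType R}.

(** * Inner product calculus *)

Section Inner.
Context {E : hilbertModType B}.
Implicit Types (x y z : E) (b : B).

Lemma innerDl x y z : inner (x + y) z = inner x z + inner y z.
Proof. by rewrite -inner_star innerDr cstarD !inner_star. Qed.
Lemma innerNr x y : inner x (- y) = - inner x y.
Proof. by rewrite -scaleN1r innerZr scaleN1r. Qed.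
Lemma innerNl x y : inner (- x) y = - inner x y.
Proof. by rewrite -inner_star innerNr cstarN inner_star. Qed.
Lemma innerBr x y z : inner x (y - z) = inner x y - inner x z.
Proof. by rewrite innerDr innerNr. Qed.
Lemma innerBl x y z : inner (x - y) z = inner x z - inner y z.
Proof. by rewrite innerDl innerNl. Qed.
Lemma innerZl (t : R) x y : inner (t%:C%C *: x) y = t%:C%C *: inner x y.
Proof. by rewrite -inner_star innerZr cstarZr inner_star. Qed.
Lemma inner_actl x y b : inner (act x b) y = cmul (cstar b) (inner x y).
Proof. by rewrite -inner_star inner_act cstarM inner_star. Qed.

Lemma rn_inner x : rn (inner x x) = rn x ^+ 2.
Proof. by apply: complexI; rewrite rmorphXn/= -!rnE inner_norm. Qed.

Lemma inner_eq0 x : inner x x = 0 -> x = 0.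
Proof. by move=> h; apply/rn_eq0/eqP; rewrite -sqrf_eq0 -rn_inner h rn0. Qed.

Lemma inner_inj x y : (forall z, inner z x = inner z y) -> x = y.
Proof.
move=> H; apply/eqP; rewrite -subr_eq0; apply/eqP/inner_eq0.
by rewrite innerBr H subrr.
Qed.

Lemma bpos_inner x : bpos (inner x x).
Proof. by have [b ->] := inner_positive x; exact: bpos_star_mul. Qed.

End Inner.

(** * Contractions and their kernels *)

(* With [k = (<x, x> + e)^(-1/2)], contractivity at the vectors [x k b], for all
   [b] in [B], says that [k <v x, v x> k <= 1]. *)
Lemma contractive_inner (E F : hilbertModType B) (v : E -> F) x :
  right_linear v -> contractive v -> bpos (inner x x - inner (v x) (v x)).
Proof.
move=> [_ _ vact] vc; have [z zE] := inner_positive x.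
have [y yE] := inner_positive (v x).
pose Z : multiplier B := mult_left z; pose W : multiplier B := mult_left y.
rewrite /bpos zE yE mult_leftB !mult_leftM -!mult_left_star -/Z -/W.
apply: pos_approx => e e0.
have pX := pos_star_mul Z.
have [s [ss _ sE sc]] := pos_sqrt e0 pX.
have [k' [sk' _ k'2 k'c]] := pos_inv e0 pX.
have Xs : GRing.comm (ustar Z * Z) s by exact: sc.
have sk's : s * k' = k' * s by apply: k'c; exact/commr_sym.
(* [k] is the inverse of [s], written as [s] times the inverse of [s^2]. *)
pose k := s * k'.
have sk : k * s = 1 by rewrite /k -mulrA -sk's mulrA sE.
have ks : s * k = 1 by rewrite /k mulrA sE.
have kk : ustar k = k by exact: saM.
have Zk : nrm (Z * k) <= 1.
  rewrite -(@ler_sqr R) ?nnegrE ?nrm_ge0// expr1n -nrm_star_mul.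
  apply: pos_nrm_le => //; first exact: pos_star_mul.
  have -> : 1%:U - ustar (Z * k) * (Z * k) = e%:U * (ustar k * k).
    have -> : ustar (Z * k) * (Z * k) = k * (ustar Z * Z) * k.
      by rewrite ustarM kk !mulrA.
    have -> : ustar Z * Z = s * s - e%:U by rewrite sE addrK.
    have -> : k * (s * s - e%:U) * k = (k * s) * (s * k) - k * e%:U * k by ncring.
    by rewrite kk sk ks mul1r emb1 -embC mulrA opprB addrC subrK.
  by apply: posZ; [exact: ltW|exact: pos_star_mul].
(* [k] is only a multiplier, but [k b] lies in [B] and can act on [x]; contractivity of [v] there
   gives [|W k b| <= |Z k b| <= |b|]. *)
have Wk : nrm (W * k) <= 1.
  apply: mult_norm_le => // b; rewrite mul1r.
  rewrite -(@ler_sqr R) ?nnegrE ?rn_ge0//.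
  have xE : rn (act x (k b)) ^+ 2 = rn (Z (k b)) ^+ 2.
    by rewrite -rn_inner inner_act inner_actl zE -rn_star_mul cstarM !cmulA.
  have vxE : rn (v (act x (k b))) ^+ 2 = rn (W (k b)) ^+ 2.
    by rewrite vact -rn_inner inner_act inner_actl yE -rn_star_mul cstarM !cmulA.
  rewrite [X in X ^+ 2](_ : _ = rn (W (k b)))// -vxE.
  apply: (@le_trans _ _ (rn (act x (k b)) ^+ 2)).
    rewrite ler_sqr ?nnegrE ?rn_ge0// -lecR -!rnE; exact: vc.
  rewrite xE ler_sqr ?nnegrE ?rn_ge0//.
  apply: le_trans (rn_mult_le (Z * k) b) _.
  by rewrite ler_piMl ?rn_ge0.
have p1 : pos (1 - ustar (W * k) * (W * k)).
  rewrite -emb1; apply: pos_nrm_sub; first exact: sa_star_mul.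
  by rewrite nrm_star_mul expr_le1// nrm_ge0.
(* Conjugating by [s] cancels [k] and turns 1 into [<x, x> + e]. *)
have := pos_conj s p1; rewrite ss.
have -> : s * (1 - ustar (W * k) * (W * k)) * s = ustar Z * Z + e%:U - ustar W * W.
  rewrite ustarM kk -sE.
  have -> : s * (1 - k * ustar W * (W * k)) * s =
    s * s - (s * k) * (ustar W * W) * (k * s) by ncring.
  by rewrite ks sk mul1r mulr1.
by rewrite addrAC.
Qed.

Lemma right_linearB (E F : hilbertModType B) (v : E -> F) : right_linear v ->
  {morph v : x y / x - y}.
Proof. by move=> [vD vZ _] x y; rewrite -scaleN1r vD vZ scaleN1r. Qed.

(* Compare [<e, e>] with [<e - k b, e - k b>] for [b] a small multiple of
   [<k, e>]. *)
Lemma orthogonal_ker (E F : hilbertModType B) (v : E -> F) e k :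
  right_linear v -> contractive v ->
  inner (v e) (v e) = inner e e -> v k = 0 -> inner k e = 0.
Proof.
move=> vl vc ve vk; pose a := inner k e.
have [_ vZ vact] := vl.
pose c := rn (inner k k); have c0 : 0 <= c by exact: rn_ge0.
have c1 : 0 < c + 1 by lra.
(* With this [t], [t^2 a^* <k, k> a <= t a^* a], which cannot offset the term [- 2 t a^* a]; the
   added 1 covers [k = 0]. *)
pose t := (c + 1)^-1; have t0 : 0 < t by rewrite invr_gt0.
pose y := e - t%:C%C *: act k a.
have vy : v y = v e.
  rewrite (right_linearB vl) vZ vact vk.
  have -> : act (0 : F) a = 0.
    by rewrite -[X in act X a](scale0r (0 : F)) actZl scale0r.
  by rewrite scaler0 subr0.
have := contractive_inner y vl vc; rewrite vy ve /bpos.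
pose La : multiplier B := mult_left a; pose K : multiplier B := mult_left (inner k k).
have -> : mult_left (inner y y - inner e e) =
   (t ^+ 2)%:U * (ustar La * K * La) - t%:U * (ustar La * La) - t%:U * (ustar La * La)
   :> multiplier B.
  have -> : inner y y - inner e e =
     t%:C%C *: (t%:C%C *: cmul (cmul (cstar a) (inner k k)) a)
     - t%:C%C *: cmul (cstar a) a - t%:C%C *: cmul (cstar a) a.
    have zB (u1 u2 u3 u4 : B) : u1 - u2 - (u3 - u4) - u1 = u4 - u2 - u3.
      by rewrite opprB addrAC [u1 - u2]addrC addrK addrA [- u2 + _]addrC.
    rewrite innerBl !innerBr zB !innerZr !innerZl inner_act !inner_actl.
    by rewrite inner_act -(inner_star k e).
  rewrite !mult_leftB !mult_leftZ !mult_leftM -!mult_left_star -/La -/K.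
  by rewrite expr2 embM !mulrA.
have pK : pos ((c + 1)%:U - K).
  apply: pos_nrm_sub; first by rewrite /sa mult_left_star inner_star.
  by apply: mult_norm_le => [|x]; [lra|apply: le_trans (rnM _ _) _; rewrite ler_wpM2r ?rn_ge0 //; lra].
have t20 : 0 <= t ^+ 2 by exact: sqr_ge0.
move=> pD; have := posD pD (posZ t20 (pos_conj La pK)).
have -> : ustar La * ((c + 1)%:U - K) * La =
    (c + 1)%:U * (ustar La * La) - ustar La * K * La.
  rewrite mulrBr mulrBl -embC mulrA; ncring.
have -> : (t ^+ 2)%:U * (ustar La * K * La) - t%:U * (ustar La * La)
   - t%:U * (ustar La * La)
   + (t ^+ 2)%:U * ((c + 1)%:U * (ustar La * La) - ustar La * K * La) =
   ((t ^+ 2)%:U * (c + 1)%:U - t%:U) * (ustar La * La) - t%:U * (ustar La * La)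
   by ncring.
have -> : t ^+ 2 = t * (c + 1)^-1 by rewrite expr2.
rewrite -embM divfK ?gt_eqF// subrr mul0r sub0r => nt.
have := posZ (ltW c1) nt; rewrite mulrN (mulrA (c + 1)%:U) -embM mulfV ?gt_eqF// emb1 mul1r.
rewrite mult_left_star -mult_leftM => nP.
apply: cstar_mul_eq0; apply: bpos_antisym; first exact: bpos_star_mul.
by rewrite /bpos -sub0r mult_leftB mult_left0 sub0r.
Qed.

(** * The initial projection *)

Section PartialIsometry.
Context {E F : hilbertModType B} {v : E -> F} (hv : partial_isometry v).
Notation p := (initial_projection v).

Lemma partial_isometry_right_linear : right_linear v. Proof. by case: hv. Qed.
Lemma partial_isometry_contractive : contractive v. Proof. by case: hv. Qed.

(** [p x] is the preimage [e] of [v x] in [E']. Any [z] differs from some [f] in [E'] by a vector of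
    [ker v], orthogonal to [e], so [<z, e> = <f, e> = <v z, v x>]. *)
Lemma initial_projection_mem x :
  (forall y, inner y (p x) = inner (v y) (v x)) /\ v (p x) = v x.
Proof.
have [_ _ vl vc [E' [_ [vE' vE'E]]]] := hv.
have lift y : exists2 e, E' e & v e = v y.
  by have : range v (v y) by [exists y]; rewrite -vE'E => -[e E'e ve]; exists e.
have adj y e : E' e -> v e = v y -> forall z, inner z e = inner (v z) (v y).
  move=> E'e ve z; have [f E'f vf] := lift z.
  have vk : v (z - f) = 0 by rewrite (right_linearB vl) vf subrr.
  have := orthogonal_ker vl vc (vE' _ _ E'e E'e) vk.
  by rewrite innerBl => /eqP; rewrite subr_eq0 => /eqP ->; rewrite -vE'// vf ve.
have [e E'e ve] := lift x.
suff -> : p x = e by split => // y; exact: (adj x e).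
(* [e] meets the specification, so [xget] does not fall back on its default 0, and [inner_inj] makes
   the value unique. *)
rewrite /initial_projection /corestr_adj; case: xgetP => [y _ [_ yP]|/(_ e)[]].
  by apply: inner_inj => z; rewrite yP (adj x e).
by split; [exists x|exact: (adj x e)].
Qed.

Lemma inner_initial_projection x y : inner x (p y) = inner (v x) (v y).
Proof. by case: (initial_projection_mem y). Qed.
Lemma initial_projectionK x : v (p x) = v x.
Proof. by case: (initial_projection_mem x). Qed.

Lemma initial_projection_idem x : p (p x) = p x.
Proof.
by apply: inner_inj => z; rewrite !inner_initial_projection initial_projectionK.
Qed.

Lemma initial_projection_right_linear : right_linear p.
Proof.
have [vD vZ vact] := partial_isometry_right_linear.
split=> *; apply: inner_inj => z;
  rewrite !(innerDr, innerZr, inner_act) !inner_initial_projection.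
- by rewrite vD innerDr.
- by rewrite vZ innerZr.
- by rewrite vact inner_act.
Qed.

Lemma rn_initial_projection x : rn (p x) = rn (v x).
Proof.
apply/eqP; rewrite -(@eqrXn2 _ 2) ?rn_ge0// -!rn_inner.
by rewrite inner_initial_projection initial_projectionK.
Qed.

(** Pythagoras for [p]: it expresses the failure of [v] to preserve [<x, x>] as a positive
    element. *)
Lemma inner_sub_initial_projection x :
  inner (x - p x) (x - p x) = inner x x - inner (v x) (v x).
Proof.
rewrite innerBl !innerBr !inner_initial_projection initial_projectionK.
by rewrite -(inner_star x (p x)) inner_initial_projection inner_star subrr subr0.
Qed.

End PartialIsometry.

(** * Closed sets and submodules *)

Lemma closed_approx (V : hilbertModType B) (S : set V) : closed S ->
  forall x, (forall e : R, 0 < e -> exists2 y, S y & rn (x - y) <= e) -> S x.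
Proof.
move=> clS x H; apply: clS => U /nbhs_ballP[e /= e0 eU].
have eE : e = (complex.Re e)%:C%C by rewrite RRe_real// gtr0_real.
have re0 : 0 < complex.Re e by rewrite -ltcR -eE.
have [|y Sy xy] := H (complex.Re e / 2); first by lra.
exists y; split => //; apply: eU; rewrite -ball_normE /= rnE eE ltcR; lra.
Qed.

Lemma approx_closed_set (V : hilbertModType B) (S : set V) :
  (forall x, (forall e : R, 0 < e -> exists2 y, S y & rn (x - y) <= e) -> S x) ->
  closed S.
Proof.
move=> H x clx; apply: H => e e0.
have [|y [Sy]] := clx (ball x e%:C%C); first by apply: nbhsx_ballx; rewrite ltcR.
rewrite -ball_normE /= rnE ltcR => xy; exists y => //; exact: ltW.
Qed.

Lemma right_linear_comp (D E F : hilbertModType B) (v : E -> F) (w : D -> E) :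
  right_linear v -> right_linear w -> right_linear (v \o w).
Proof.
move=> [vD vZ vA] [wD wZ wA]; split=> * /=.
- by rewrite wD vD.
- by rewrite wZ vZ.
- by rewrite wA vA.
Qed.

Lemma right_linear0 (E F : hilbertModType B) (v : E -> F) : right_linear v -> v 0 = 0.
Proof. by move=> vl; rewrite -[X in v X](subrr (0 : E)) (right_linearB vl) subrr. Qed.

Lemma submodule_range (E F : hilbertModType B) (v : E -> F) :
  right_linear v -> submodule (range v).
Proof.
move=> vl; have [vD vZ vA] := vl; split.
- by exists 0 => //; exact: right_linear0.
- by move=> _ _ [x _ <-] [y _ <-]; exists (x + y).
- by move=> k _ [x _ <-]; exists (k *: x).
- by move=> _ b [x _ <-]; exists (act x b).
Qed.

Lemma submodule_equalizer (E F : hilbertModType B) (v w : E -> F) :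
  right_linear v -> right_linear w -> submodule [set x | v x = w x].
Proof.
move=> vl wl; have [vD vZ vA] := vl; have [wD wZ wA] := wl; split => /=.
- by rewrite !right_linear0.
- by move=> x y vx vy; rewrite vD wD vx vy.
- by move=> k x vx; rewrite vZ wZ vx.
- by move=> x b vx; rewrite vA wA vx.
Qed.

Lemma submoduleI (E : hilbertModType B) (S T : set E) :
  submodule S -> submodule T -> submodule (S `&` T).
Proof.
move=> [S0 SD SZ SA] [T0 TD TZ TA]; split=> //.
- by move=> x y [Sx Tx] [Sy Ty]; split; [exact: SD|exact: TD].
- by move=> k x [Sx Tx]; split; [exact: SZ|exact: TZ].
- by move=> x b [Sx Tx]; split; [exact: SA|exact: TA].
Qed.

(** * Composition of partial isometries *)

Section Composition.
Context {D E F : hilbertModType B} {v : E -> F} {w : D -> E}.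
Context (hv : partial_isometry v) (hw : partial_isometry w).
Notation p := (initial_projection v).
Notation q := (initial_projection w).

(* [v] is isometric on [range w] intersected with [range p], a complete space
   whose image is the range of [v \o w]. *)
Lemma closed_range_comp :
  (forall x, exists y, p (w x) = w y) -> closed (range (v \o w)).
Proof.
move=> pw; apply: approx_closed_set => z Hz.
have vl := partial_isometry_right_linear hv.
have pl := initial_projection_right_linear hv.
have [[_ clw] _ _ _ _] := hw.
have : forall n : nat, exists x, rn (z - v (w x)) <= 2^-1 ^+ n.
  move=> n; have [|_ [x _ <-] zx] := Hz (2^-1 ^+ n); first by rewrite exprn_gt0.
  by exists x.
(* [v] is isometric on the range of [p], so the geometric rate of [v (w (x n))] passes to [u]; the
   factor 2 below dominates [1 + 1/2]. *)
move=> /choice[x xz]; pose u n := p (w (x n)).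
have [|n|l ul] := @geometric_lim R E u 2 2^-1; first by lra.
  rewrite /u -(right_linearB pl) rn_initial_projection// (right_linearB vl).
  have -> : v (w (x n.+1)) - v (w (x n)) =
      (z - v (w (x n))) - (z - v (w (x n.+1))).
    by rewrite opprB [RHS]addrC addrA subrK.
  apply: le_trans (rnB _ _) _.
  have h1 := xz n; have := xz n.+1; rewrite exprS.
  have : 0 <= 2^-1 ^+ n :> R by rewrite exprn_ge0.
  lra.
(* The hypothesis [pw] keeps [u] in the range of [w], which is closed. *)
have [y _ yl] : range w l.
  apply: (closed_approx clw) => e e0.
  have [N HN] := @geometric_small R (2 / (1 - 2^-1)) 2^-1 e ltac:(lra) e0.
  exists (u N); first by have [y py] := pw (x N); exists y.
  by rewrite rn_distC; apply: le_trans (ul N) (HN _ (leqnn N)).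
exists y => //=; rewrite yl; apply/eqP; rewrite -subr_eq0; apply/eqP/rn_approx0 => e e0.
have [N HN] := @geometric_small R (2 / (1 - 2^-1) + 1) 2^-1 e ltac:(lra) e0.
apply: le_trans (HN _ (leqnn N)).
have -> : v l - z = - (v (u N) - v l) - (z - v (u N)).
  by rewrite !opprB addrA subrK.
apply: le_trans (rnB _ _) _; rewrite rnN mulrDl mul1r; apply: lerD.
  rewrite -(right_linearB vl); apply: le_trans (ul N).
  rewrite -lecR -!rnE; exact: partial_isometry_contractive.
by rewrite /u initial_projectionK.
Qed.

Lemma partial_isometry_comp :
  (forall x, exists y, p (w x) = w y) -> partial_isometry (v \o w).
Proof.
move=> pw.
have vl := partial_isometry_right_linear hv.
have wl := partial_isometry_right_linear hw.
have pl := initial_projection_right_linear hv.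
have ql := initial_projection_right_linear hw.
have vwl := right_linear_comp vl wl.
split => //.
- by split; [exact: submodule_range|exact: closed_range_comp].
- move=> x; apply: (le_trans (partial_isometry_contractive hv _)).
  exact: partial_isometry_contractive.
exists ([set x | q x = x] `&` [set x | (p \o w) x = w x]); split.
  apply: submoduleI; last by apply: submodule_equalizer => //; exact: right_linear_comp.
  by apply: (@submodule_equalizer _ _ q id).
split=> [x y [_ _] [/= qy py]|].
  by rewrite -(inner_initial_projection hv) py -(inner_initial_projection hw) qy.
apply/seteqP; split=> [_ [x _ <-]|_ [x _ <-]]; first by exists x.
(* [v w x = v p w x = v w y = v w q y], and [q y] satisfies both equations of the initial space. *)
have [y py] := pw x; exists (q y).
  split => /=; first exact: initial_projection_idem.
  by rewrite (initial_projectionK hw) -py initial_projection_idem.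
by rewrite /= (initial_projectionK hw) -py initial_projectionK.
Qed.

(* For [x] in the initial space of [v \o w], both contractions [w] and [v]
   preserve <x, x>, so [w x] is in the initial space of [v]. *)
Lemma initial_projection_comp :
  partial_isometry (v \o w) -> forall x, exists y, p (w x) = w y.
Proof.
move=> hvw x; pose y := initial_projection (v \o w) x; exists y.
have vwy : v (w y) = v (w x) := initial_projectionK hvw x.
(* [p] depends on its argument only through the value of [v]. *)
have -> : p (w x) = p (w y) by rewrite /initial_projection vwy.
have yy : inner (v (w y)) (v (w y)) = inner y y.
  rewrite -[LHS](inner_initial_projection hvw).
  by rewrite /y (initial_projection_idem hvw).
have ip := inner_sub_initial_projection hv (w y).
have iq := inner_sub_initial_projection hw y.
have k0 : inner (w y - p (w y)) (w y - p (w y)) = 0.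
  apply: bpos_antisym; first exact: bpos_inner.
  by rewrite ip yy opprB -iq; exact: bpos_inner.
by apply/eqP; rewrite eq_sym -subr_eq0; apply/eqP/inner_eq0.
Qed.

End Composition.
End HilbertModule.

Theorem lemma3p4 (R : realType) (B : cstarAlgType R)
    (D E F : hilbertModType B) (v : E -> F) (w : D -> E)
    (hv : partial_isometry v) (hw : partial_isometry w) :
  (partial_isometry (v \o w) <->
     leaves_invariant (initial_projection v) (range w)) /\
  (leaves_invariant (initial_projection v) (range w) <->
     forall x : D, exists y : D, initial_projection v (w x) = w y).
Proof.
have invP : leaves_invariant (initial_projection v) (range w) <->
    forall x : D, exists y : D, initial_projection v (w x) = w y.
  split=> [H x|H _ [_ [x _ <-] <-]].
    have [|y _ yE] := H (initial_projection v (w x)); last by exists y.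
    by exists (w x) => //; exists x.
  by have [y yE] := H x; exists y.
split=> //; split=> [hvw|/invP]; last exact: partial_isometry_comp.
by apply/invP; exact: initial_projection_comp.
Qed.
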